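(* Let $a>b>0$, let $\mathcal{E}:\ \frac{\mathsf{x}^2}{a}+\frac{\mathsf{y}^2}{b}=1$, and let $\mathcal{C}_{\lambda_0}$, $\lambda_0\in(0,b)\cup(b,a)$, be a conic confocal with $\mathcal{E}$. Let $$\sqrt{(a-x)(b-x)(\lambda_0-x)}=B_0+B_1x+B_2x^2+\dots,\qquad \frac{\sqrt{(a-x)(b-x)(\lambda_0-x)}}{\lambda_0-x}=C_0+C_1x+C_2x^2+\dots$$ be the Taylor expansions around $x=0$. Let $n\ge 3$ be an integer. The billiard trajectories within $\mathcal{E}$ with caustic $\mathcal{C}_{\lambda_0}$ are $n$-periodic if and only if: - for $n=2m+1$ odd ($n=3,5,7,\dots$): $\det\left(C_{i+j}\right)_{i,j=1}^{m}=0$, that is, $$C_2=0,\quad \begin{vmatrix} C_2 & C_3 \\ C_3 & C_4 \end{vmatrix}=0,\quad \begin{vmatrix} C_2 & C_3 & C_4 \\ C_3 & C_4 & C_5 \\ C_4 & C_5 & C_6 \end{vmatrix}=0,\ \dots$$ respectively; - for $n=2m$ even ($n=4,6,8,\dots$): $\det\left(B_{i+j+1}\right)_{i,j=1}^{m-1}=0$, that is, $$B_3=0,\quad \begin{vmatrix} B_3 & B_4 \\ B_4 & B_5 \end{vmatrix}=0,\quad \begin{vmatrix} B_3 & B_4 & B_5 \\ B_4 & B_5 & B_6 \\ B_5 & B_6 & B_7 \end{vmatrix}=0,\ \dots$$ respectively.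
   Context: The confocal family is $\mathcal{C}_{\lambda}:\ \frac{\mathsf{x}^2}{a-\lambda}+\frac{\mathsf{y}^2}{b-\lambda}=1$; $\mathcal{C}_\lambda$ is an ellipse for $\lambda<b$ and a hyperbola for $\lambda\in(b,a)$. A billiard trajectory within $\mathcal{E}$ is a polygonal line with vertices on $\mathcal{E}$ obeying the reflection law (angle of incidence equals angle of reflection) at each vertex; it has caustic $\mathcal{C}_{\lambda_0}$ if all lines containing its segments are tangent to $\mathcal{C}_{\lambda_0}$. A trajectory is $n$-periodic if it closes after $n$ reflections ($n$ is not required to be minimal); by Poncelet's theorem this property depends only on the caustic. *)

(* Defs.v *)
From mathcomp Require Import all_boot all_order all_algebra.
From mathcomp Require Import all_classical all_reals all_analysis.

Set Implicit Arguments.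
Unset Strict Implicit.
Unset Printing Implicit Defensive.

Import Order.TTheory GRing.Theory Num.Theory.
Import numFieldNormedType.Exports.

Local Open Scope ring_scope.

Section Billiard.
Variable R : realType.
Implicit Types (a b lam : R) (P Q N u v : R * R) (p : nat -> R * R).

Definition dot u v : R := u.1 * v.1 + u.2 * v.2.
Definition cross u v : R := u.1 * v.2 - u.2 * v.1.
Definition enorm u : R := Num.sqrt (dot u u).

Definition on_ellipse a b P : Prop := P.1 ^+ 2 / a + P.2 ^+ 2 / b = 1.

(* Normal vector at P (half the gradient of the left-hand side above). *)
Definition ellipse_normal a b P : R * R := (P.1 / a, P.2 / b).

(* Cosine and sine of the oriented angle from N to u. *)
Definition cos_angle N u : R := dot N u / (enorm N * enorm u).
Definition sin_angle N u : R := cross N u / (enorm N * enorm u).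

(* The oriented angles that the segments [Q, P] and [Q, P'] make with the
   normal at Q are opposite: same cosine, opposite sine. *)
Definition reflection_law a b P Q P' : Prop :=
  let N := ellipse_normal a b Q in
  cos_angle N (P - Q) = cos_angle N (P' - Q) /\
  sin_angle N (P - Q) = - sin_angle N (P' - Q).

Definition billiard_trajectory a b p : Prop :=
  [/\ forall k, on_ellipse a b (p k),
      forall k, p k <> p k.+1
    & forall k, reflection_law a b (p k) (p k.+1) (p k.+2)].

(* The line through P and Q is the tangent to the confocal conic C_lam at its
   point (X : Y : Z). Homogeneous coordinates are used because the asymptotes
   of a hyperbola are tangent to it at its points at infinity (Z = 0). *)
Definition tangent_line a b lam P Q : Prop :=
  exists X Y Z : R,
    [/\ (X, Y, Z) <> (0, 0, 0),
        X ^+ 2 / (a - lam) + Y ^+ 2 / (b - lam) = Z ^+ 2,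
        X * P.1 / (a - lam) + Y * P.2 / (b - lam) = Z
      & X * Q.1 / (a - lam) + Y * Q.2 / (b - lam) = Z].

Definition has_caustic a b lam p : Prop :=
  forall k, tangent_line a b lam (p k) (p k.+1).

(* n is a period, not necessarily the least one. *)
Definition periodic n p : Prop := forall k, p (k + n)%N = p k.

Definition trajectories_periodic a b lam n : Prop :=
  forall p, billiard_trajectory a b p -> has_caustic a b lam p -> periodic n p.

Definition taylor_coef (f : R -> R) k : R := derive1n k f 0 / k`!%:R.

Definition Bcoef a b lam : nat -> R :=
  taylor_coef (fun x => Num.sqrt ((a - x) * (b - x) * (lam - x))).

Definition Ccoef a b lam : nat -> R :=
  taylor_coef
    (fun x => Num.sqrt ((a - x) * (b - x) * (lam - x)) / (lam - x)).

End Billiard.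

(* Main.v *)
Require Import Defs.
From mathcomp Require Import all_boot all_order all_algebra.
From mathcomp Require Import all_classical all_reals all_analysis.
From mathcomp Require Import ring zify.
Import Order.TTheory GRing.Theory Num.Theory.
Import numFieldNormedType.Exports.
Local Open Scope ring_scope.

Set Implicit Arguments.
Unset Strict Implicit.
Unset Printing Implicit Defensive.

(** Let f = (a - x)(b - x)(l - x) and restrict the quadratic forms of the
    confocal family to the line of the k-th segment, in the basis given by its
    two vertices.  Up to normalisation this is a traceless matrix L_k(x) with
    L_k^2 = f, and the reflection law yields A_k L_k = L_{k+1} A_k with A_k
    linear in x and det A_k a multiple of x^2.  At x = a (resp. x = b) the
    kernel of L_k is spanned by the abscissas (resp. ordinates) of the two
    vertices, and A_k transports these kernels.

    If the trajectory is n-periodic, M = A_{n-1} ... A_0 commutes with L_0,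
    hence M = p + q L_0 with p^2 - q^2 f = x^(2n), p(a) = a^n and p(b) = b^n.
    Conversely such p, q force M = p + q L_0, because M and p + q L_0 both
    intertwine and both have their kernel at x = 0 on the same branch, so that
    M (p - q L_0) is divisible by x^(2n).

    Factoring (p - x^n)(p + x^n) = q^2 f into coprime factors turns this into
    P^2 - Q^2 f = c x^n for n even, and P^2 (l - x) - Q^2 (a - x)(b - x) = c x^n
    for n odd.  Solvability means that the power series of sqrt f, resp.
    sqrt f / (l - x), has a Pade approximant of exceptional order, which is the
    vanishing of the Hankel determinant. *)

(** * Polynomial preliminaries: coprime factors of a square, divisibility by powers of ['X] *)

(** Up to a unit, [gcdp B q] is a square root of B: its square divides q^2 = A B and is coprime to
    A, hence divides B, and B divides its square by Bezout. The scalar c appears because a constant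
    of F need not be a square; the same c serves both factors. *)
Lemma coprimep_mul_sqr (F : fieldType) (A B q : {poly F}) :
  q != 0 -> coprimep A B -> A * B = q ^+ 2 ->
  exists (c : F) (P Q : {poly F}), [/\ c != 0, c%:P * B = P ^+ 2 & c%:P * A = Q ^+ 2].
Proof.
move=> q0 cAB ABq.
have B0 : B != 0.
  by apply: contra_neq q0 => B0; apply/eqP; rewrite -sqrf_eq0 -ABq B0 mulr0.
pose w := gcdp B q.
have wB : w %| B by exact: dvdp_gcdl.
have wq : w %| q by exact: dvdp_gcdr.
have Bw : B %| w ^+ 2.
  have [u /andP[uw _]] := Bezoutp B q.
  apply: dvdp_trans (dvdp_exp2r 2 uw).
  have -> : (u.1 * B + u.2 * q) ^+ 2 =
            (u.1 ^+ 2 * B + 2 * u.1 * u.2 * q + u.2 ^+ 2 * A) * B.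
    by rewrite sqrrD !exprMn -ABq; ring.
  exact: dvdp_mull.
have wB2 : w ^+ 2 %| B.
  have : w ^+ 2 %| A * B by rewrite ABq dvdp_exp2r.
  rewrite Gauss_dvdpr // coprimep_pexpl // coprimep_sym.
  exact: coprimep_dvdl wB cAB.
have /eqpP[[c1 c2] /= /andP[c10 c20] Hc] : B %= w ^+ 2 by rewrite /eqp Bw wB2.
have [q1 q1E] := dvdpP _ _ wq.
set c := c1 / c2; have E : c%:P * B = w ^+ 2.
  by rewrite mul_polyC /c mulrC -scalerA Hc scalerA mulVf // scale1r.
exists c, w, (c%:P * q1); split=> //; first by rewrite mulf_neq0 ?invr_neq0.
apply: (mulIf B0); rewrite -mulrA ABq q1E -/w; ring: E.
Qed.

Lemma coprime_expX (F : fieldType) n (q : {poly F}) :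
  q.[0] != 0 -> coprimep 'X^n q.
Proof. by move=> q0; rewrite coprimep_expl // coprimep_sym coprimepX. Qed.

Lemma expX_dvdpP (F : fieldType) n (p : {poly F}) :
  reflect (forall i, (i < n)%N -> p`_i = 0) ('X^n %| p).
Proof.
apply: (iffP (dvdpP _ _)) => [[q ->] i ni|p0]; first by rewrite coefMXn ni.
exists (drop_poly n p); rewrite -{1}(poly_take_drop n p) -[RHS]add0r.
congr (_ + _); apply/polyP => i; rewrite coef_take_poly coef0.
by case: ifP => // /p0.
Qed.

Lemma expX_dvdp_const (F : fieldType) n (p : {poly F}) :
  'X^n %| p -> (size p <= n.+1)%N -> p = (p`_n)%:P * 'X^n.
Proof.
move=> /expX_dvdpP p0 sp; apply/polyP => i; rewrite coefCM coefXn.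
case: (ltngtP i n) => [/p0 ->|ni|->]; rewrite ?mulr0 ?mulr1 //.
by rewrite nth_default // (leq_trans sp).
Qed.

(** * Pell equations and Pade approximants *)

Section Pell.
Variable R : realFieldType.
Implicit Types (f P Q S : {poly R}).

(** The condition at 0 excludes solutions with the common factor ['X]; the size bound forces the
    leading term of c x^n to come from P^2 f1. *)
Definition pell_solvable (f1 f2 : {poly R}) (n : nat) :=
  exists (c : R) (P Q : {poly R}), [/\ c != 0, P ^+ 2 * f1 - Q ^+ 2 * f2 = c%:P * 'X^n,
    P.[0] != 0 & (size (Q ^+ 2 * f2)%R <= n)%N].

(** Modulo x^n, P = Q S and S^2 f1 = f2 give P^2 f1 = Q^2 f2, and the degree bounds leave only a
    constant multiple of x^n in the difference. *)
Lemma pell_of_approx f1 f2 S n P Q :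
  f1.[0] != 0 -> S.[0] != 0 -> odd (size (f1 * f2)%R) = false ->
  'X^(n.+1) %| S ^+ 2 * f1 - f2 -> Q != 0 -> 'X^n %| P - Q * S ->
  (size (P ^+ 2 * f1)%R <= n.+1)%N -> (size (Q ^+ 2 * f2)%R <= n)%N ->
  pell_solvable f1 f2 n.
Proof.
move=> f10 S0 oddf /dvdpP[u uE] Q0 /dvdpP[v vE] sP sQ.
have f1n0 : f1 != 0 by apply: contra_neq f10 => ->; rewrite horner0.
have f2n0 : f2 != 0.
  have : (S ^+ 2 * f1 - f2).[0] = 0 by rewrite uE !hornerE expr0n /= mulr0.
  apply: contra_eq_neq => ->; rewrite subr0 !hornerE mulf_neq0 //.
  by rewrite mulf_neq0.
have PE : P ^+ 2 * f1 - Q ^+ 2 * f2 =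
   (v * (P + Q * S) * f1 + Q ^+ 2 * u * 'X) * 'X^n.
  have -> : P ^+ 2 * f1 - Q ^+ 2 * f2 = (P - Q * S) * (P + Q * S) * f1
     + Q ^+ 2 * (S ^+ 2 * f1 - f2) by ring.
  by rewrite vE uE (exprSr 'X); ring.
have sz : (size (P ^+ 2 * f1 - Q ^+ 2 * f2)%R <= n.+1)%N.
  by apply: leq_trans (size_polyD _ _) _; rewrite geq_max size_polyN sP (leqW sQ).
have dv : 'X^n %| P ^+ 2 * f1 - Q ^+ 2 * f2 by rewrite PE dvdp_mull.
have cE := expX_dvdp_const dv sz.
set c := nth _ _ _ in cE.
have c0 : c != 0.
  (* With c = 0 the polynomials P^2 f1 and Q^2 f2 would be equal, so f1 and f2 would have degrees of
     the same parity, against the odd degree of f1 f2. *)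
  apply/eqP => c0; move: cE; rewrite c0 mul0r => /eqP; rewrite subr_eq0 => /eqP E.
  have P0 : P != 0.
    apply/eqP => P0; move/eqP: E; rewrite P0 expr0n /= mul0r eq_sym.
    by rewrite mulf_eq0 sqrf_eq0 (negPf Q0) (negPf f2n0).
  move/(congr1 (fun p : {poly R} => odd (size p))): E; move: oddf.
  rewrite !expr2 !size_mul ?mulf_neq0 //.
  move=> /= A B; move: f1n0 f2n0 P0 Q0 A B; rewrite -!size_poly_gt0.
  move: (size P) (size Q) (size f1) (size f2); clear=> *; lia.
exists c, P, Q; split => //.
(* If P(0) = 0 then Q(0) = 0 because S(0) is nonzero, and c, the value at 0 of the cofactor in [PE],
   vanishes. *)
apply: contra_neq c0 => P0.
have Q00 : Q.[0] = 0.
  have : (P - Q * S).[0] = 0.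
    rewrite vE; case: (n) sQ => [|n' _]; last by rewrite !hornerE expr0n /= mulr0.
    by rewrite leqn0 size_poly_eq0 mulf_eq0 sqrf_eq0 (negPf Q0) (negPf f2n0).
  move/eqP; rewrite !hornerE P0 sub0r oppr_eq0 mulf_eq0 (negPf S0) orbF.
  by move/eqP.
have /eqP : (c%:P : {poly R}).[0] = 0.
  have Xn : 'X^n != 0 :> {poly R} by rewrite monic_neq0 // monicXn.
  have -> : c%:P = v * (P + Q * S) * f1 + Q ^+ 2 * u * 'X.
    by apply: (mulIf Xn); rewrite -cE.
  by rewrite !hornerE P0 Q00; ring.
by rewrite hornerC => /eqP.
Qed.

(** The power x^n divides (P - Q S)(P + Q S). As P(0) is nonzero, only one of the two factors
    vanishes at 0 and absorbs the whole power; the sign of Q is changed accordingly. *)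
Lemma approx_of_pell f1 f2 S n :
  f1.[0] != 0 -> 'X^n %| S ^+ 2 * f1 - f2 -> (0 < n)%N ->
  pell_solvable f1 f2 n ->
  exists P Q : {poly R}, [/\ Q != 0, 'X^n %| P - Q * S, (size (P ^+ 2 * f1)%R <= n.+1)%N
    & (size (Q ^+ 2 * f2)%R <= n)%N].
Proof.
move=> f10 Sf n0 [c [P [Q [c0 E P0 sQ]]]].
have Xn0 : ('X^n : {poly R}).[0] = 0 by rewrite hornerXn expr0n gtn_eqF.
have dv : 'X^n %| (P ^+ 2 - Q ^+ 2 * S ^+ 2) * f1.
  have -> : (P ^+ 2 - Q ^+ 2 * S ^+ 2) * f1 =
     (P ^+ 2 * f1 - Q ^+ 2 * f2) - Q ^+ 2 * (S ^+ 2 * f1 - f2) by ring.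
  by rewrite E dvdp_sub // dvdp_mull.
rewrite Gauss_dvdpl ?coprime_expX // in dv.
have sP : (size (P ^+ 2 * f1)%R <= n.+1)%N.
  have -> : P ^+ 2 * f1 = c%:P * 'X^n + Q ^+ 2 * f2 by rewrite -E; ring.
  apply: leq_trans (size_polyD _ _) _; rewrite geq_max (leqW sQ) andbT.
  by rewrite size_Cmul // size_polyXn.
have {}dv : 'X^n %| (P - Q * S) * (P + Q * S).
  by rewrite (_ : _ * _ = P ^+ 2 - Q ^+ 2 * S ^+ 2) //; ring.
have : (P.[0] - Q.[0] * S.[0]) * (P.[0] + Q.[0] * S.[0]) = 0.
  case/dvdpP: dv => q /(congr1 (horner^~ 0)).
  by rewrite /= !hornerM Xn0 mulr0 !hornerE.
have H : forall Z, P.[0] = Z.[0] * S.[0] -> Z != 0.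
  by move=> Z ZE; apply: contra_neq P0 => Z0; rewrite ZE Z0 horner0 mul0r.
move/eqP; rewrite mulf_eq0 => /orP[|] /eqP h.
- have h' : P.[0] = Q.[0] * S.[0] by apply/eqP; rewrite -subr_eq0 h.
  exists P, Q; split => //; first exact: H.
  rewrite Gauss_dvdpl ?coprime_expX // in dv; rewrite !hornerE -h'.
  by rewrite -mulr2n mulrn_eq0.
- have h' : P.[0] = (- Q).[0] * S.[0].
    by apply/eqP; rewrite hornerN mulNr -subr_eq0 opprK h.
  exists P, (- Q); split => //; rewrite ?sqrrN //; first exact: H.
  rewrite mulNr opprK; rewrite Gauss_dvdpr ?coprime_expX // in dv.
  rewrite hornerD hornerN hornerM -mulNr -hornerN -h'.
  by rewrite -mulr2n mulrn_eq0.
Qed.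

End Pell.

(** * Hankel determinants and gaps in the coefficients of a product *)

Section Hankel.
Variable F : fieldType.
Implicit Types (c : nat -> F) (Q : {poly F}).

Lemma coef_mul_hankel c N r s Q (i : 'I_r.+1) :
  (size Q <= r.+1)%N -> (r + s + r < N)%N ->
  (Q * \poly_(k < N) c k)`_(r + s + i) =
  \sum_(j < r.+1) Q`_(r - j) * c (j + i + s)%N.
Proof.
move=> sQ rN; rewrite coefM.
rewrite -(big_mkord xpredT (fun k => Q`_k * (\poly_(k < N) c k)`_(r + s + i - k))).
have ri : (r.+1 <= (r + s + i).+1)%N by lia.
rewrite (big_cat_nat _ ri) //= [X in _ + X]big_nat [X in _ + X]big1 ?addr0; last first.
  by move=> k /andP[rk _]; rewrite nth_default ?mul0r // (leq_trans sQ).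
rewrite big_mkord (reindex_inj rev_ord_inj) /=; apply: eq_bigr => j _.
have := ltn_ord j; have := ltn_ord i => ir jr.
rewrite subSS coef_poly; have -> : (r + s + i - (r - j) = j + i + s)%N by lia.
by have -> : (j + i + s < N)%N by lia.
Qed.

(** A kernel vector read backwards is the list of coefficients of Q: reversal turns the convolution
    into rows of a Hankel matrix. The r equations say that Q times the series has r consecutive zero
    coefficients, and N only has to reach beyond them. *)
Lemma hankel_det0P c N r s : (r.*2 + s < N.+2)%N ->
  \det (\matrix_(i < r, j < r) c (i + j + s)%N) = 0 <->
  exists2 Q : {poly F}, (Q != 0) && (size Q <= r)%N &
    forall i, (i < r)%N -> (Q * \poly_(k < N) c k)`_(r.-1 + s + i) = 0.
Proof.
case: r => [|r] rN.
  split=> [/eqP|[Q /andP[Q0]]]; first by rewrite det_mx00 oner_eq0.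
  by rewrite leqn0 size_poly_eq0 (negPf Q0).
have {}rN : (r + s + r < N)%N by move: rN; lia.
set A := \matrix_(_, _) _; split=> [/eqP/det0P[v v0 vA]|[Q /andP[Q0 sQ] QA]].
  pose Q := \poly_(k < r.+1) v 0 (inord (r - k)).
  have QE (j : 'I_r.+1) : Q`_(r - j) = v 0 j.
    by rewrite coef_poly ltnS leq_subr subKn ?inord_val // -ltnS.
  exists Q.
    rewrite size_poly andbT; apply: contra_neq v0 => Q0.
    by apply/rowP => j; rewrite -QE Q0 coef0 mxE.
  move=> i ir; rewrite (coef_mul_hankel c (Ordinal ir)) ?size_poly //.
  move/rowP/(_ (Ordinal ir)): vA; rewrite !mxE => vA; rewrite -[RHS]vA.
  by apply: eq_bigr => j _; rewrite QE !mxE.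
apply/eqP/det0P; exists (\row_j Q`_(r - j)).
  apply: contra_neq Q0 => v0; apply/polyP => k; rewrite coef0.
  have [kr|rk] := leqP k r; last by rewrite nth_default // (leq_trans sQ).
  move/rowP/(_ (inord (r - k))): v0; rewrite !mxE inordK ?ltnS ?leq_subr //.
  by rewrite subKn.
apply/rowP => i; rewrite !mxE -[RHS](QA i (ltn_ord i)) /= coef_mul_hankel //.
by apply: eq_bigr => j _; rewrite !mxE.
Qed.

End Hankel.

Section PellHankel.
Variable R : realFieldType.
Implicit Types (f P Q : {poly R}) (c : nat -> R).

(** The degree bounds read deg P <= m and deg Q < r, so P approximates Q S to order n = m + 1 + r
    exactly when the coefficients of Q S in positions m + 1 to m + r vanish. *)
Lemma pell_solvable_hankel f1 f2 c n m r s :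
  (r.-1 + s = m.+1)%N -> n = (m.+1 + r)%N ->
  odd (size (f1 * f2)%R) = false -> f1.[0] != 0 -> c 0%N != 0 ->
  (forall P, (size (P ^+ 2 * f1)%R <= n.+1)%N = (size P <= m.+1)%N) ->
  (forall Q, (size (Q ^+ 2 * f2)%R <= n)%N = (size Q <= r)%N) ->
  'X^(n.+1) %| (\poly_(k < n.+1) c k) ^+ 2 * f1 - f2 ->
  pell_solvable f1 f2 n <-> \det (\matrix_(i < r, j < r) c (i + j + s)%N) = 0.
Proof.
move=> rsm nE oddf f10 c0 size1 size2 dvdS; set S := \poly_(k < _) _ in dvdS.
have S0 : S.[0] != 0 by rewrite horner_coef0 coef_poly.
have nz : (0 < n)%N by rewrite nE.
rewrite (@hankel_det0P _ c n.+1) -/S; last by lia.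
rewrite rsm; split.
  have dvdS' : 'X^n %| S ^+ 2 * f1 - f2.
    by apply: dvdp_trans dvdS; rewrite dvdp_exp2l.
  move/(approx_of_pell f10 dvdS' nz) => [P [Q [Q0 dv]]].
  rewrite size1 size2 => sP sQ; exists Q; first by rewrite Q0.
  move=> i ir; have /expX_dvdpP/(_ (m.+1 + i)%N) := dv.
  rewrite nE ltn_add2l => /(_ ir).
  rewrite coefB nth_default ?(leq_trans sP) ?leq_addr // sub0r => /eqP.
  by rewrite oppr_eq0 => /eqP.
move=> [Q /andP[Q0 sQ] QS].
(* The numerator P is the part of Q S below the gap. *)
apply: (@pell_of_approx _ f1 f2 S n (take_poly m.+1 (Q * S)) Q) => //.
- apply/expX_dvdpP => i; rewrite nE coefB coef_take_poly => ir.
  case: ltnP => mi; first by rewrite subrr.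
  by rewrite -(subnKC mi) QS ?subr0 // ltn_subLR.
- by rewrite size1 size_take_poly.
- by rewrite size2.
Qed.

End PellHankel.

(** * From the two Pell equations to the one of norm x^(2n), and back *)

Section Mid.
Variable R : realFieldType.
Variables a b l s : R.
Implicit Types (p q P Q : {poly R}).

Definition cubic : {poly R} := (a%:P - 'X) * (b%:P - 'X) * (l%:P - 'X).

(* [p + q L_0] is then the monodromy of [n] reflections. *)
Definition unit_pell (n : nat) :=
  exists p q : {poly R}, [/\ p ^+ 2 - q ^+ 2 * cubic = 'X^(n * 2), p \is monic,
    (size p = n.+1) /\ (size q < n)%N, p.[0] = s * q.[0] /\ p.[0] != 0
    & p.[a] = a ^+ n /\ p.[b] = b ^+ n].

(** Squaring: (P sqrt f1 + Q sqrt f2)^2 / c = p + q sqrt f has norm x^(2n). Since p = x^n + 2 Q^2 f2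
    / c, it is monic and takes the values a^n and b^n at the roots a and b of f2. *)
Lemma unit_pell_of_pell f1 f2 n : (0 < n)%N -> s != 0 ->
  s ^+ 2 = a * b * l -> f1 * f2 = cubic -> (size f1 + size f2 = 5)%N ->
  f1.[0] != 0 -> f2.[a] = 0 -> f2.[b] = 0 ->
  pell_solvable f1 f2 n -> unit_pell n.
Proof.
move=> n0 s0 s2 fE sf f10 f2a f2b [c [P [Q [c0 E P0 sQ]]]].
have f1n0 : f1 != 0 by apply: contra_neq f10 => ->; rewrite horner0.
have c0P : c^-1%:P * c%:P = 1 :> {poly R} by rewrite -polyCM mulVf.
pose p := c^-1%:P * (P ^+ 2 * f1 + Q ^+ 2 * f2).
pose q := c^-1%:P * (2 * P * Q).
have pE : p = 'X^n + c^-1%:P * 2 * (Q ^+ 2 * f2).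
  have -> : p = c^-1%:P * (P ^+ 2 * f1 - Q ^+ 2 * f2) + c^-1%:P * 2 * (Q ^+ 2 * f2).
    by rewrite /p; ring.
  by rewrite E; ring: c0P.
have sp : (size (c^-1%:P * 2 * (Q ^+ 2 * f2))%R <= n)%N.
  rewrite -mulrA -polyC_natr mulrA -polyCM size_Cmul //.
  by rewrite mulf_neq0 ?invr_neq0 ?pnatr_eq0.
have pq : p ^+ 2 - q ^+ 2 * cubic = 'X^(n * 2).
  rewrite -fE exprM /p /q; have -> : 'X^n = c^-1%:P * (c%:P * 'X^n) :> {poly R}.
    by rewrite mulrA c0P mul1r.
  by rewrite -E; ring.
have cub0 : cubic.[0] = s ^+ 2 by rewrite s2 /cubic !hornerE !subr0.
have P1 : P ^+ 2 != 0.
  by rewrite sqrf_eq0; apply: contra_neq P0 => ->; rewrite horner0.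
have p0 : p.[0] != 0.
  move/(congr1 (horner^~ 0)): E; rewrite /= !hornerE expr0n gtn_eqF // mulr0 => /eqP.
  rewrite subr_eq0 => /eqP E0; rewrite /p ?hornerE -E0 -mulr2n -mulr_natr.
  by rewrite !mulf_neq0 ?invr_neq0 ?pnatr_eq0 ?sqrf_eq0.
(* Adding the two degree bounds, with deg f1 + deg f2 = 3, gives 2 deg (P Q) + 3 <= 2 n - 1. *)
have sPQ : (size (P * Q)%R < n)%N.
  have sP : (size (P ^+ 2 * f1)%R <= n.+1)%N.
    have -> : P ^+ 2 * f1 = c%:P * 'X^n + Q ^+ 2 * f2 by rewrite -E; ring.
    apply: leq_trans (size_polyD _ _) _; rewrite geq_max (leqW sQ) andbT.
    by rewrite size_Cmul // size_polyXn.
  have f2n0 : f2 != 0.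
    apply/eqP => f20; move: pq p0; rewrite -fE f20 !mulr0 subr0.
    move/(congr1 (horner^~ 0)); rewrite /= !hornerE expr0n muln_eq0 gtn_eqF //=.
    by move/eqP; rewrite sqrf_eq0 => ->.
  have [->|Q0] := eqVneq Q 0; first by rewrite mulr0 size_poly0.
  have Pn0 : P != 0 by rewrite -sqrf_eq0.
  move: sP sQ; rewrite !expr2 !size_mul ?mulf_neq0 //.
  move: f1n0 f2n0 Pn0 Q0 sf; rewrite -!size_poly_gt0.
  move: (size P) (size Q) (size f1) (size f2); clear=> *; lia.
have sq : (size q < n)%N.
  have -> : q = (c^-1 * 2)%:P * (P * Q) by rewrite /q polyCM polyC_natr; ring.
  rewrite size_Cmul //.
  by rewrite mulf_neq0 ?invr_neq0 ?pnatr_eq0.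
have sXn : (size (c^-1%:P * 2 * (Q ^+ 2 * f2))%R < size ('X^n : {poly R}))%N.
  by rewrite size_polyXn ltnS.
have pm : p \is monic by rewrite monicE pE lead_coefDl // lead_coefXn.
have szp : size p = n.+1 by rewrite pE size_polyDl ?size_polyXn.
have pa : p.[a] = a ^+ n by rewrite pE hornerD hornerXn !hornerM f2a !mulr0 addr0.
have pb : p.[b] = b ^+ n by rewrite pE hornerD hornerXn !hornerM f2b !mulr0 addr0.
have : (p.[0] - s * q.[0]) * (p.[0] + s * q.[0]) = 0.
  move/(congr1 (horner^~ 0)): pq; rewrite /= hornerD hornerN (hornerM (q ^+ 2)).
  rewrite !horner_exp hornerX cub0 expr0n muln_eq0 gtn_eqF //=.
  by move=> h; apply: etrans h; ring.
(* Both signs of q solve the equation; the one kept has p(0) = s q(0), which selects the branch of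
   sqrt f at 0. *)
move/eqP; rewrite mulf_eq0 => /orP[|] /eqP h.
  by exists p, q; split => //; split => //; apply/eqP; rewrite -subr_eq0 h.
exists p, (- q); split => //; rewrite ?sqrrN ?size_polyN //; split => //.
by apply/eqP; rewrite -subr_eq0 hornerN mulrN opprK h.
Qed.

Lemma dvdp_subCX c p : (c%:P - 'X %| p) = root p c.
Proof. by rewrite -opprB dvdpNl dvdp_XsubCl. Qed.

(** The factors A = p - x^n and B = p + x^n of q^2 f are coprime because p(0) is nonzero. The values
    of p put the roots a and b of f in A. What remains is where the root l goes; B has degree n, so
    this also decides the parity of n. *)
Lemma pell_of_unit_pell n : (0 < n)%N -> s != 0 -> l != 0 -> a != b ->
  unit_pell n ->
  odd n /\ pell_solvable (l%:P - 'X) ((a%:P - 'X) * (b%:P - 'X)) n \/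
  ~~ odd n /\ pell_solvable 1 cubic n.
Proof.
move=> n0 s0 l0 ab [p [q [pq pm [sp sq] [ps p0] [pa pb]]]].
have q0 : q != 0 by apply: contra_neq p0 => q0; rewrite ps q0 horner0 mulr0.
pose A := p - 'X^n; pose B := p + 'X^n.
have BA : B - A = 2%:P * 'X^n by rewrite /A /B; ring.
have AB : A * B = q ^+ 2 * cubic.
  by rewrite -[RHS](subKr (p ^+ 2)) pq exprM /A /B; ring.
have Xn0 : ('X^n : {poly R}).[0] = 0 by rewrite hornerXn expr0n gtn_eqF.
have two : (2 : R) != 0 by rewrite pnatr_eq0.
have cAB : coprimep A B.
  have -> : B = 1 * A + 2%:P * 'X^n by rewrite -BA; ring.
  rewrite coprimep_addl_mul mul_polyC coprimepZr // coprimep_sym.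
  by rewrite coprime_expX // /A hornerD hornerN Xn0 subr0.
have B0 : B.[0] != 0 by rewrite /B hornerD Xn0 addr0.
have sA : (size A <= n)%N.
  apply/leq_sizeP => j; rewrite leq_eqVlt coefB coefXn => /predU1P[<-|nj].
    by move: pm; rewrite monicE lead_coefE sp /= eqxx => /eqP ->; rewrite subrr.
  by rewrite nth_default ?sp // gtn_eqF // subrr.
have sB : size B = n.+1.
  have -> : B = 2%:P * 'X^n + A by rewrite -BA; ring.
  by rewrite size_polyDl size_Cmul ?size_polyXn.
have Aa : root A a by rewrite /root /A hornerD hornerN hornerXn pa subrr.
have Ab : root A b by rewrite /root /A hornerD hornerN hornerXn pb subrr.
have [A' A'E] : exists A', A = (a%:P - 'X) * (b%:P - 'X) * A'.
  move: Aa; rewrite -dvdp_subCX => /dvdpP[A1 A1E].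
  move: Ab; rewrite A1E rootM {2}/root !hornerE subr_eq0 (negPf ab) orbF.
  by rewrite -dvdp_subCX => /dvdpP[A2 ->]; exists A2; ring.
have pol0 : (a%:P - 'X) * (b%:P - 'X) != 0 :> {poly R}.
  by rewrite mulf_neq0 // -opprB oppr_eq0 polyXsubC_eq0.
have A'B : A' * B = q ^+ 2 * (l%:P - 'X).
  by apply: (mulfI pol0); rewrite mulrA -A'E AB /cubic; ring.
have l0P : (l%:P - 'X : {poly R}) != 0 by rewrite -opprB oppr_eq0 polyXsubC_eq0.
have szl : size (l%:P - 'X : {poly R}) = 2 by rewrite -opprB size_polyN size_XsubC.
have P0 P (f : {poly R}) (c : R) : c != 0 -> P ^+ 2 * f = c%:P * B -> P.[0] != 0.
  move=> c0 E; have : (P ^+ 2 * f).[0] != 0 by rewrite E hornerM hornerC mulf_neq0.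
  by apply: contra_neq; rewrite hornerM horner_exp => ->; rewrite expr0n mul0r.
have Bn0 : B != 0 by apply: contra_neq B0 => ->; rewrite horner0.
(* If l - x divides B, then B is l - x times a square up to a constant and n is odd; otherwise B is
   itself such a square and n is even. The constant 2 c below comes from B - A = 2 x^n. *)
have : root (A' * B) l by rewrite A'B rootM -[X in _ || X]dvdp_subCX dvdpp orbT.
rewrite rootM -!dvdp_subCX orbC => /orP[] /dvdpP[D DE].
- left; have E : A' * D = q ^+ 2.
    by apply: (mulIf l0P); rewrite -A'B DE; ring.
  have cA'D : coprimep A' D.
    apply: coprimep_dvdl (_ : D %| B) _; first by rewrite DE dvdp_mulr.
    by apply: coprimep_dvdr cAB; rewrite A'E dvdp_mull.
  have [c [P [Q [c0 PE QE]]]] := coprimep_mul_sqr q0 cA'D E.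
  have PB : P ^+ 2 * (l%:P - 'X) = c%:P * B by rewrite -PE DE; ring.
  have QA : Q ^+ 2 * ((a%:P - 'X) * (b%:P - 'X)) = c%:P * A.
    by rewrite -QE A'E; ring.
  have Pz := P0 _ _ _ c0 PB.
  have Pn0 : P != 0 by apply: contra_neq Pz => ->; rewrite horner0.
  split.
    have := congr1 (size \o (@polyseq R)) PB.
    rewrite /= expr2 !size_mul ?mulf_neq0 ?polyC_eq0 //.
    rewrite szl size_polyC c0 sB; move: Pn0; rewrite -size_poly_gt0.
    by move: (size P); clear => k; lia.
  exists (c * 2), P, Q; split => //; first by rewrite mulf_neq0.
    by rewrite PB QA -mulrBr BA polyCM mulrA.
  by rewrite QA size_Cmul.
- right; have E : D * B = q ^+ 2.
    by apply: (mulIf l0P); rewrite -A'B DE; ring.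
  have cDB : coprimep D B.
    apply: coprimep_dvdr cAB; rewrite A'E DE; apply: dvdp_mull; exact: dvdp_mulr.
  have [c [P [Q [c0 PE QE]]]] := coprimep_mul_sqr q0 cDB E.
  have PB : P ^+ 2 * 1 = c%:P * B by rewrite mulr1 PE.
  have QA : Q ^+ 2 * cubic = c%:P * A.
    by rewrite -QE A'E DE /cubic; ring.
  have Pz := P0 _ _ _ c0 PB.
  have Pn0 : P != 0 by apply: contra_neq Pz => ->; rewrite horner0.
  split.
    have := congr1 (size \o (@polyseq R)) PB.
    rewrite /= mulr1 expr2 !size_mul ?polyC_eq0 //.
    rewrite size_polyC c0 sB; move: Pn0; rewrite -size_poly_gt0.
    by move: (size P); clear => k; lia.
  exists (c * 2), P, Q; split => //; first by rewrite mulf_neq0.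
    by rewrite PB QA -mulrBr BA polyCM mulrA.
  by rewrite QA size_Cmul.
Qed.

End Mid.

(** * Taylor polynomials of smooth functions *)

Section Taylor.
Variables (R : realType) (U : set R).
Hypothesis oU : open U.
Implicit Types (h : R -> R) (u : {poly R}).

Lemma near_open_eq h1 h2 x : U x -> (forall y, U y -> h1 y = h2 y) ->
  \near x, h1 x = h2 x.
Proof. by move=> Ux h12; apply: filterS (open_nbhs_nbhs (conj oU Ux)). Qed.

Lemma derive1n_eq_open h1 h2 k : (forall y, U y -> h1 y = h2 y) ->
  forall x, U x -> derive1n k h1 x = derive1n k h2 x.
Proof.
move=> h12; elim: k => [//|k IH] x Ux.
rewrite !derive1nS !derive1E; apply: near_eq_derive; exact: near_open_eq.
Qed.

Definition smooth_on h := forall k x, U x -> derivable (derive1n k h) x 1.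

Lemma smooth_on_eq h1 h2 : (forall y, U y -> h1 y = h2 y) ->
  smooth_on h1 -> smooth_on h2.
Proof.
move=> h12 s1 k x Ux; apply: near_eq_derivable (s1 k x Ux).
by apply: near_open_eq => // y; apply: derive1n_eq_open.
Qed.

Lemma is_derive_smooth h k x : smooth_on h -> U x ->
  is_derive x 1 (derive1n k h) (derive1n k.+1 h x).
Proof.
by move=> sh Ux; rewrite derive1nS derive1E; apply: DeriveDef => //; apply: sh.
Qed.

Lemma is_derive_mulXD (g1 g0 g2 : R -> R) (x c e d1 d0 d2 : R) :
  is_derive x 1 g1 d1 -> is_derive x 1 g0 d0 -> is_derive x 1 g2 d2 ->
  is_derive x 1 (fun y : R => y * g1 y + e * g0 y + c * g2 y)
    (x * d1 + g1 x + e * d0 + c * d2).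
Proof.
move=> D1 D0 D2.
have D4 : is_derive x 1 (fun y : R => y * g1 y) (x * d1 + g1 x).
  by apply: is_derive_eq; rewrite /GRing.scale /= mulr1.
have D3 : is_derive x 1 (fun y : R => e * g0 y) (e * d0) by exact: is_derive_eq.
have D5 : is_derive x 1 (fun y : R => c * g2 y) (c * d2) by exact: is_derive_eq.
exact: is_deriveD (is_deriveD D4 D3) D5.
Qed.

(** Leibniz rule for one multiplication by the variable, in the shape of a Horner step. At k = 0 the
    term with [k.-1] is killed by its factor k. *)
Lemma derive1n_mulXD h1 h2 c : smooth_on h1 -> smooth_on h2 ->
  forall k x, U x -> derive1n k (fun y => y * h1 y + c * h2 y) x =
    x * derive1n k h1 x + k%:R * derive1n k.-1 h1 x + c * derive1n k h2 x.
Proof.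
move=> s1 s2; elim=> [|k IH] x Ux; first by rewrite !derive1n0 mul0r addr0.
rewrite derive1nS derive1E.
transitivity ('D_1 (fun y : R => y * derive1n k h1 y +
    k%:R * derive1n k.-1 h1 y + c * derive1n k h2 y) x).
  by apply: near_eq_derive; apply: near_open_eq.
have [_ D] := is_derive_mulXD c k%:R (is_derive_smooth k s1 Ux)
  (is_derive_smooth k.-1 s1 Ux) (is_derive_smooth k s2 Ux).
apply: etrans D _; rewrite /= -natr1.
by case: (k) => [|j] /=; ring.
Qed.

Lemma smooth_mulXD h1 h2 c : smooth_on h1 -> smooth_on h2 ->
  smooth_on (fun y => y * h1 y + c * h2 y).
Proof.
move=> s1 s2 k x Ux.
have [D _] := is_derive_mulXD c k%:R (is_derive_smooth k s1 Ux)
  (is_derive_smooth k.-1 s1 Ux) (is_derive_smooth k s2 Ux).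
apply: near_eq_derivable D.
by apply: near_open_eq => // y Uy; exact/esym/derive1n_mulXD.
Qed.

Definition taylor_poly N h : {poly R} := \poly_(k < N) taylor_coef h k.

Lemma taylor_coef_eq h1 h2 k : U 0 -> (forall y, U y -> h1 y = h2 y) ->
  taylor_coef h1 k = taylor_coef h2 k.
Proof. by move=> U0 h12; rewrite /taylor_coef (derive1n_eq_open k h12 U0). Qed.

Lemma taylor_coef_mulXD h1 h2 c k : U 0 -> smooth_on h1 -> smooth_on h2 ->
  taylor_coef (fun y => y * h1 y + c * h2 y) k =
  (if k is j.+1 then taylor_coef h1 j else 0) + c * taylor_coef h2 k.
Proof.
move=> U0 s1 s2; rewrite /taylor_coef derive1n_mulXD // mul0r add0r mulrDl -mulrA.
congr (_ + _); last by rewrite mulrA.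
case: k => [|k] /=; first by rewrite !mul0r.
by rewrite factS natrM invfM mulrCA (mulrA k.+1%:R) divff ?mul1r // pnatr_eq0.
Qed.

(** Horner induction on u. Equality holds only modulo x^N, since the product on the left is not
    truncated. *)
Lemma taylor_poly_mul u h N : U 0 -> smooth_on h ->
  smooth_on (fun y => u.[y] * h y) /\
  'X^N %| u * taylor_poly N h - taylor_poly N (fun y => u.[y] * h y).
Proof.
move=> U0 sh; elim/poly_ind: u => [|u c [su IH]].
  have -> : (fun y => (0 : {poly R}).[y] * h y) = cst 0.
    by apply/funext => y; rewrite horner0 mul0r.
  have Z k : derive1n k (cst (0 : R)) = cst (0 : R).
    elim: k => [//|k IH]; rewrite derive1nS IH; apply/funext => y.
    by rewrite derive1E derive_cst.
  split=> [k x _|]; first by rewrite Z; exact: derivable_cst.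
  apply/expX_dvdpP => i iN; rewrite mul0r coefB coef0 coef_poly iN.
  by rewrite /taylor_coef Z mul0r subrr.
have E : (fun y => (u * 'X + c%:P).[y] * h y) =
         (fun y => y * (u.[y] * h y) + c * h y).
  by apply/funext => y; rewrite hornerD hornerM hornerX hornerC; ring.
rewrite E; split; first exact: smooth_mulXD.
apply/expX_dvdpP => i iN.
rewrite mulrDl coefB coefD -mulrA coefCM !coef_poly iN taylor_coef_mulXD //.
move: IH => /expX_dvdpP IH.
have -> : (u * ('X * taylor_poly N h))`_i =
    if i is j.+1 then (taylor_poly N (fun y => u.[y] * h y))`_j else 0.
  rewrite mulrCA mulrC coefMX; case: i iN => [//|i] iN /=.
  by apply/eqP; rewrite -subr_eq0 -coefB IH // ltnW.
case: i iN => [|i] iN; first by rewrite subrr.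
by rewrite coef_poly (ltnW iN) subrr.
Qed.

Lemma taylor_poly_deriv N h :
  (taylor_poly N.+1 h)^`() = taylor_poly N (derive1 h).
Proof.
apply/polyP => i; rewrite coef_deriv !coef_poly ltnS.
case: ifP => _; last by rewrite mul0rn.
rewrite /taylor_coef derive1Sn factS natrM invfM.
by rewrite -[LHS]mulr_natl mulrCA (mulrA i.+1%:R) divff ?mul1r // pnatr_eq0.
Qed.

Lemma smooth_derive1 h : smooth_on h -> smooth_on (derive1 h).
Proof. by move=> sh k x Ux; rewrite -derive1Sn; apply: sh. Qed.

End Taylor.

(** * Taylor polynomials of sqrt f and sqrt f / (l - x) *)

Section SqrtTaylor.
Variable R : realType.
Implicit Types (f q e : {poly R}).

Lemma open_horner_gt0 f : open [set x : R | 0 < f.[x]]%classic.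
Proof.
apply: (@open_comp _ _ (horner f) [set y | 0 < y]%classic); last exact: open_gt.
by move=> x _; apply: continuous_horner.
Qed.

(* The derivatives of [sqrt f] stay of the form [sqrt f * q / f ^ m]. *)
Definition sqrt_frac f q m (x : R) := Num.sqrt f.[x] * q.[x] / (f ^+ m).[x].

Lemma is_derive_sqrt_frac f q m x : 0 < f.[x] ->
  is_derive x 1 (sqrt_frac f q m) (sqrt_frac f
    (q^`() * f + (2^-1)%:P * (q * f^`()) - m%:R%:P * (q * f^`())) m.+1 x).
Proof.
move=> fx; have s0 : Num.sqrt f.[x] != 0 by rewrite gt_eqF // sqrtr_gt0.
have f0 : f.[x] != 0 by rewrite gt_eqF.
have fm0 : (f ^+ m).[x] != 0 by rewrite horner_exp expf_neq0.
have D1 := is_derive1_comp (is_derive1_sqrt fx) (is_derive_poly f x).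
have D2 := is_deriveV fm0 (is_derive_poly (f ^+ m) x).
pose S := Num.sqrt f.[x].
have D : is_derive x 1 (sqrt_frac f q m)
    (S * q.[x] * (- (f ^+ m).[x] ^- 2 * (f ^+ m)^`().[x]) +
     (f ^+ m).[x]^-1 * (S * q^`().[x] + q.[x] * ((2 * S)^-1 * f^`().[x]))).
  exact: is_deriveM (is_deriveM D1 (is_derive_poly q x)) D2.
apply: (is_derive_eq D); rewrite /sqrt_frac -/S.
have SE : f.[x] = S ^+ 2 by rewrite sqr_sqrtr // ltW.
rewrite deriv_exp hornerMn !hornerM !hornerD !hornerN !hornerM !hornerC !horner_exp.
rewrite -[_ *+ m]mulr_natl; clear D D1 D2 fm0; move: s0 f0 SE; rewrite -/S.
move: S (f.[x]) (q.[x]) (f^`().[x]) (q^`().[x]) => S F Q F' Q' s0 f0 SE.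
case: m => [|m]; first by rewrite !expr0 expr1 SE; field.
rewrite /= !exprS; have := expf_neq0 m f0; move: (F ^+ m) => Fm Fm0; rewrite SE.
by field; rewrite s0 Fm0.
Qed.

Lemma derive1n_sqrt_frac f k : forall q m, exists q' m',
  forall x, 0 < f.[x] -> derive1n k (sqrt_frac f q m) x = sqrt_frac f q' m' x.
Proof.
elim: k => [|k IH] q m; first by exists q, m.
have [q' [m' E]] := IH
  (q^`() * f + (2^-1)%:P * (q * f^`()) - m%:R%:P * (q * f^`())) m.+1.
exists q', m' => x fx; rewrite derive1Sn -E //.
apply: (derive1n_eq_open (@open_horner_gt0 f)) => // y fy.
by rewrite derive1E; have [_] := is_derive_sqrt_frac q m fy.
Qed.

Lemma smooth_sqrt_frac f q m : smooth_on [set x | 0 < f.[x]]%classic (sqrt_frac f q m).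
Proof.
move=> k x fx; have [q' [m' E]] := derive1n_sqrt_frac f k q m.
have [D _] := is_derive_sqrt_frac q' m' fx.
apply: near_eq_derivable D.
by apply: (near_open_eq (@open_horner_gt0 f)) => // y fy; rewrite E.
Qed.

(** E = S^2 - f satisfies E' f = f' E modulo x^N and E(0) = 0. If E = E1 x^(j+1), the coefficient of
    x^j in this equation is (j + 1) E1(0) f(0), so E1(0) = 0 and the order of vanishing grows by
    one. *)
Lemma sqr_of_ode f S N : f.[0] != 0 -> S.[0] ^+ 2 = f.[0] ->
  'X^N %| 2%:P * f * S^`() - f^`() * S -> 'X^(N.+1) %| S ^+ 2 - f.
Proof.
move=> f0 S0 dv; set E := S ^+ 2 - f.
have {}dv : 'X^N %| E^`() * f - f^`() * E.
  have -> : E^`() * f - f^`() * E = S * (2%:P * f * S^`() - f^`() * S).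
    by rewrite /E derivB expr2 derivM polyC_natr; ring.
  exact: dvdp_mull.
suff H j : (j <= N)%N -> 'X^(j.+1) %| E by exact: H.
elim: j => [_|j IH jN].
  rewrite expr1 -['X]subr0 -polyC0 dvdp_XsubCl /root.
  by rewrite hornerD hornerN horner_exp S0 subrr.
have /dvdpP[E1 E1E] := IH (ltnW jN).
have Xj : ('X^j : {poly R}) != 0 by rewrite monic_neq0 // monicXn.
have : 'X^j * 'X %| 'X^j * (E1^`() * 'X * f + j.+1%:R * (E1 * f) - f^`() * E1 * 'X).
  rewrite -exprSr; apply: (@dvdp_trans _ 'X^N); first by rewrite dvdp_exp2l.
  rewrite (_ : 'X^j * _ = E^`() * f - f^`() * E) //.
  by rewrite E1E derivM derivXn /= -[_ *+ j.+1]mulr_natl exprSr; ring.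
rewrite dvdp_mul2l // -{1}['X]subr0 -polyC0 dvdp_XsubCl /root.
rewrite hornerD hornerN hornerD !hornerM hornerX !mulr0 mul0r add0r subr0.
rewrite -polyC_natr hornerC !mulf_eq0 pnatr_eq0 (negPf f0) orbF /= => E10.
rewrite E1E (mulrC E1) (exprSr _ j.+1) dvdp_mul2l ?expf_neq0 ?polyX_eq0 //.
by rewrite -{1}['X]subr0 -polyC0 dvdp_XsubCl.
Qed.

(** F = sqrt f solves 2 f F' = f' F. This equation involves only products with polynomials, so it
    passes to Taylor polynomials, and [sqr_of_ode] then yields the square. *)
Lemma sqrt_taylor f N : 0 < f.[0] ->
  'X^(N.+1) %| taylor_poly N.+1 (fun x => Num.sqrt f.[x]) ^+ 2 - f.
Proof.
move=> f0; pose U := [set x | 0 < f.[x]]%classic; pose F := fun x => Num.sqrt f.[x].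
have oU : open U := @open_horner_gt0 f.
have sF : smooth_on U F.
  apply: (smooth_on_eq oU (h1 := sqrt_frac f 1 0)) => [x _|]; last first.
    exact: smooth_sqrt_frac.
  by rewrite /sqrt_frac expr0 !hornerC divr1 mulr1.
apply: sqr_of_ode; first by rewrite gt_eqF.
  rewrite horner_coef0 coef_poly /= /taylor_coef derive1n0 divr1.
  by rewrite sqr_sqrtr // ltW.
have [_ d1] := taylor_poly_mul oU (2%:P * f) N f0 (smooth_derive1 sF).
have [_ d2] := taylor_poly_mul oU f^`() N f0 sF.
rewrite taylor_poly_deriv -/F.
have d3 : taylor_poly N (fun y => (2%:P * f).[y] * derive1 F y) =
          taylor_poly N (fun y => f^`().[y] * F y).
  apply/polyP => i; rewrite !coef_poly; case: ifP => // _.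
  apply: (taylor_coef_eq oU) => // y fy.
  have [_ D] := is_derive1_comp (is_derive1_sqrt fy) (is_derive_poly f y).
  rewrite derive1E D hornerM hornerC.
  have s0 : F y != 0 by rewrite gt_eqF // sqrtr_gt0.
  have sE : f.[y] = F y ^+ 2 by rewrite sqr_sqrtr // ltW.
  rewrite -/(F y); move: s0 sE; move: (F y) (f.[y]) (f^`().[y]) => Fy fy' f'y s0 ->.
  by field.
(* Differentiation costs one term; the truncations of F at N and N + 1 agree modulo x^N. *)
have d4 : 'X^N %| f^`() * (taylor_poly N.+1 F - taylor_poly N F).
  apply: dvdp_mull; apply/expX_dvdpP => i iN.
  by rewrite coefB !coef_poly iN ltnW // subrr.
have := dvdp_sub d1 (dvdp_add d2 d4); rewrite d3.
by congr (_ %| _); ring.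
Qed.

(** The Taylor polynomial T satisfies (l - x) T = S modulo x^(N+1), with S that of sqrt f. Squaring
    and cancelling l - x, which is nonzero at 0, gives the claim. *)
Lemma sqrt_div_taylor e l N : 0 < (e * (l%:P - 'X)).[0] -> l != 0 ->
  'X^(N.+1) %| taylor_poly N.+1
     (fun x => Num.sqrt (e * (l%:P - 'X)).[x] / (l - x)) ^+ 2 * (l%:P - 'X) - e.
Proof.
set f := e * _ => f0 l0; pose U := [set x | 0 < f.[x]]%classic.
pose G := fun x => Num.sqrt f.[x] / (l - x).
have oU : open U := @open_horner_gt0 f.
have lx x : U x -> l - x != 0.
  by move=> fx; apply/eqP => lx; move: fx; rewrite /U /= /f !hornerE lx mulr0 ltxx.
have sG : smooth_on U G.
  (* Where f > 0, 1 / (l - x) = e / f. *)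
  apply: (smooth_on_eq oU (h1 := sqrt_frac f e 1)) => [x fx|]; last first.
    exact: smooth_sqrt_frac.
  have := lx x fx; rewrite /sqrt_frac /G expr1; move: fx; rewrite /U /=.
  rewrite {1 3}/f !hornerE => fx lx'.
  have ex : e.[x] != 0 by apply/eqP => ex; move: fx; rewrite ex mul0r ltxx.
  by field; rewrite lx' ex.
have [_ d1] := taylor_poly_mul oU (l%:P - 'X) N.+1 f0 sG.
have d2 : taylor_poly N.+1 (fun y => (l%:P - 'X).[y] * G y) =
          taylor_poly N.+1 (fun y => Num.sqrt f.[y]).
  apply/polyP => i; rewrite !coef_poly; case: ifP => // _.
  apply: (taylor_coef_eq oU) => // y fy; have := lx y fy => ly.
  by rewrite /G hornerD hornerN hornerC hornerX; field.
rewrite d2 in d1; have d3 := sqrt_taylor N f0.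
set T := taylor_poly N.+1 G in d1.
set S := taylor_poly N.+1 _ in d1 d3; rewrite -/G -/T.
have : 'X^(N.+1) %| (T ^+ 2 * (l%:P - 'X) - e) * (l%:P - 'X).
  have -> : (T ^+ 2 * (l%:P - 'X) - e) * (l%:P - 'X) =
     ((l%:P - 'X) * T - S) * ((l%:P - 'X) * T + S) + (S ^+ 2 - f).
    by rewrite /f; ring.
  by apply: dvdp_add => //; apply: dvdp_mulr.
by rewrite Gauss_dvdpl // coprime_expX // !hornerE subr0.
Qed.

End SqrtTaylor.

(** * Polynomial identities by evaluation, and 2 by 2 matrices *)

(** The natural numbers are more roots than the degree of a nonzero difference allows. *)
Lemma poly_eq_horner (R : realFieldType) (p q : {poly R}) :
  (forall x, p.[x] = q.[x]) -> p = q.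
Proof.
move=> pq; apply/eqP; rewrite -subr_eq0; apply/negPn/negP => pq0.
pose rs : seq R := [seq i%:R | i <- iota 0 (size (p - q))].
have := max_poly_roots pq0 (_ : all (root (p - q)) rs) (_ : uniq rs).
rewrite size_map size_iota ltnn => H; apply/notF/H.
  by apply/allP => x _; rewrite /root hornerD hornerN pq subrr.
by rewrite map_inj_uniq ?iota_uniq // => i j /eqP; rewrite eqr_nat => /eqP.
Qed.

Section Mx2.
Variable R : pzRingType.
Implicit Types (A B : 'M[R]_2).

Definition mx2 (p q r t : R) : 'M[R]_2 :=
  \matrix_(i, j) if i == 0 then if j == 0 then p else q
                 else if j == 0 then r else t.

Lemma mx2E p q r t : ((mx2 p q r t 0 0 = p) * (mx2 p q r t 0 1 = q) *
  (mx2 p q r t 1 0 = r) * (mx2 p q r t 1 1 = t))%type.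
Proof. by rewrite !mxE. Qed.

Lemma ord2_cases (i : 'I_2) : i = 0 \/ i = 1.
Proof. by case: i => [[|[|//]] ?]; [left|right]; apply: ord_inj. Qed.

Lemma eq_mx2 A B : A 0 0 = B 0 0 -> A 0 1 = B 0 1 -> A 1 0 = B 1 0 ->
  A 1 1 = B 1 1 -> A = B.
Proof.
move=> *; apply/matrixP => i j.
by case: (ord2_cases i) => ->; case: (ord2_cases j) => ->.
Qed.

Lemma mulmx2E A B i j : (A *m B) i j = A i 0 * B 0 j + A i 1 * B 1 j.
Proof.
rewrite mxE !big_ord_recl big_ord0 addr0.
by congr (_ + A _ _ * B _ j); apply: ord_inj.
Qed.

End Mx2.

(** Three entries follow from v0 + v1 = m al alone. The upper left one, multiplied by m, is the
    equality of the two determinants. *)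
Lemma mx2_intertwine (R : idomainType) (z m al v0 v1 g0 g2 e i0 i1 : R) :
  i1 * e = 1 -> m != 0 -> v0 + v1 = m * al ->
  v0 ^+ 2 - i0 * g0 * (i0 * (z * m)) = v1 ^+ 2 - i1 * (z * m) * (i1 * g2) ->
  let A := mx2 (e * al) (- (e * i0 * z)) z 0 in
  A *m mx2 v0 (- (i0 * (z * m))) (i0 * g0) (- v0) =
  mx2 v1 (- (i1 * g2)) (i1 * (z * m)) (- v1) *m A.
Proof.
move=> ie m0 vA vS A; have v1E : v1 = m * al - v0 by rewrite -vA; ring.
apply: eq_mx2; rewrite !mulmx2E !mx2E.
- apply: (mulIf m0); apply/eqP; rewrite -subr_eq0; apply/eqP.
  transitivity (e * ((v0 ^+ 2 - i0 * g0 * (i0 * (z * m))) -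
    (v1 ^+ 2 - i1 * (z * m) * (i1 * g2)))); first by rewrite v1E; ring: ie.
  by rewrite vS; ring.
- by rewrite v1E; ring: ie.
- by rewrite v1E; ring: ie.
- by rewrite v1E; ring: ie.
Qed.

(** * Lax matrices of the segments and their monodromy *)

Section Lax.
Variable R : realFieldType.
Variables (a b l s : R) (x y d be : nat -> R).

(* Polar form, at the vertices i and j, of the conic with parameter 'X. *)
Definition confocal_form (i j : nat) : {poly R} :=
  (a%:P - 'X) * (b%:P - 'X) - (x i * x j)%:P * (b%:P - 'X)
  - (y i * y j)%:P * (a%:P - 'X).

Local Notation g := confocal_form.

(** Second elliptic coordinate of the vertex; the first one is 0 because the vertex lies on the
    ellipse. *)
Definition ell_mu k : R := a + b - x k ^+ 2 - y k ^+ 2.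
Local Notation mu := ell_mu.

(** The algebraic content of a trajectory: d is the chord length, and - [be] is the coefficient of
    the normal (x/a, y/b) in the sum of the unit vectors leaving a vertex. The Joachimsthal equation
    fixes the sign of s, which the caustic alone determines only up to sign. *)
Record lax_orbit := LaxOrbit {
  lax_a0 : a != 0;
  lax_b0 : b != 0;
  lax_s0 : s != 0;
  lax_ell : forall k, b * x k ^+ 2 + a * y k ^+ 2 = a * b;
  lax_d0 : forall k, d k != 0;
  lax_d2 : forall k, d k ^+ 2 = (x k.+1 - x k) ^+ 2 + (y k.+1 - y k) ^+ 2;
  lax_caustic : forall k,
    a * (y k.+1 - y k) ^+ 2 + b * (x k.+1 - x k) ^+ 2
      - (x k * y k.+1 - y k * x k.+1) ^+ 2 = l * d k ^+ 2;
  lax_joachimsthal : forall k,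
    a * b - b * (x k * x k.+1) - a * (y k * y k.+1) = s * d k;
  lax_recx : forall k, x k.+2 / d k.+1 + x k / d k =
    ((d k.+1)^-1 + (d k)^-1 - be k.+1 / a) * x k.+1;
  lax_recy : forall k, y k.+2 / d k.+1 + y k / d k =
    ((d k.+1)^-1 + (d k)^-1 - be k.+1 / b) * y k.+1
}.

Hypothesis H : lax_orbit.
Let a0 := lax_a0 H.
Let b0 := lax_b0 H.
Let s0 := lax_s0 H.
Let d0 := lax_d0 H.

Lemma horner_form i j z : (g i j).[z] =
  (a - z) * (b - z) - x i * x j * (b - z) - y i * y j * (a - z).
Proof. by rewrite /confocal_form !hornerE. Qed.

Lemma confocal_form_diag k : g k k = 'X * ('X - (mu k)%:P).
Proof.
apply: poly_eq_horner => z; rewrite horner_form !hornerE /mu.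
have E : y k ^+ 2 = b - b * x k ^+ 2 / a.
  have <- : a * y k ^+ 2 / a = y k ^+ 2 by field.
  by rewrite -(addKr (b * x k ^+ 2) (a * _)) lax_ell //; field.
rewrite E -!expr2 E; field; exact: a0.
Qed.

Definition vpoly k : {poly R} := (d k)^-1%:P * g k k.+1.
Local Notation v := vpoly.

Lemma horner_vpoly k z : (v k).[z] = (d k)^-1 * (g k k.+1).[z].
Proof. by rewrite /vpoly hornerM hornerC. Qed.

Definition lax k := mx2 (v k) (- ((d k)^-1%:P * g k.+1 k.+1))
  ((d k)^-1%:P * g k k) (- v k).

(** Companion matrix of the recurrence w_(k+2)/d_(k+1) + w_k/d_k = (1/d_(k+1) + 1/d_k - be_(k+1)/z)
    w_(k+1), cleared of its denominator: it sends (w_(k+1), w_k) to z (w_(k+2), w_(k+1)). The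
    abscissas solve it at z = a, the ordinates at z = b. *)
Definition step k := mx2
  ((d k.+1)%:P * (((d k.+1)^-1 + (d k)^-1)%:P * 'X - (be k.+1)%:P))
  (- ((d k.+1 / d k)%:P * 'X)) 'X 0.

Lemma horner_cubic z : (cubic a b l).[z] = (a - z) * (b - z) * (l - z).
Proof. by rewrite /cubic !hornerE. Qed.

(** The discriminant of the form restricted to the chord is (a - z)(b - z) times a factor linear in
    z, which vanishes when the conic of parameter z touches the line, that is at z = l. *)
Lemma vpoly_sqr k :
  v k ^+ 2 - (d k)^-1%:P * g k k * ((d k)^-1%:P * g k.+1 k.+1) = cubic a b l.
Proof.
apply: poly_eq_horner => z.
rewrite horner_cubic hornerD hornerN horner_exp horner_vpoly !hornerM !hornerC.
rewrite !horner_form.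
have := d0 k; have := lax_d2 H k; have := lax_caustic H k.
move: (d k) (x k) (x k.+1) (y k) (y k.+1) => D x0 x1 y0 y1.
move=> C D2 D0; apply: (mulIf (expf_neq0 2 D0)).
have -> : (a - z) * (b - z) * (l - z) * D ^+ 2 =
   (a - z) * (b - z) * (l * D ^+ 2 - z * D ^+ 2) by ring.
rewrite -C [X in _ - z * X]D2; field; exact: D0.
Qed.

(* Adding the two chords leaving a vertex, the law of reflection replaces the
   other two vertices by a combination of that vertex and its normal vector. *)
Lemma vpoly_add k : v k + v k.+1 =
  ('X - (mu k.+1)%:P) * (((d k.+1)^-1 + (d k)^-1)%:P * 'X - (be k.+1)%:P).
Proof.
apply: poly_eq_horner => z.
rewrite hornerD !horner_vpoly !horner_form !(hornerE, hornerM) /mu.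
have := lax_recx H k; have := lax_recy H k; have := lax_ell H k.+1.
move: (d0 k) (d0 k.+1).
move: (d k) (d k.+1) (x k) (x k.+1) (x k.+2) (y k) (y k.+1) (y k.+2) (be k.+1).
move=> D D1 x0 x1 x2 y0 y1 y2 B D0 D10 E Y X.
transitivity ((D^-1 + D1^-1) * (a - z) * (b - z)
  - (x2 / D1 + x0 / D) * x1 * (b - z) - (y2 / D1 + y0 / D) * y1 * (a - z)).
  by field; rewrite D0 D10.
rewrite X Y.
have E' : y1 ^+ 2 = b - b * x1 ^+ 2 / a.
  have <- : a * y1 ^+ 2 / a = y1 ^+ 2 by field.
  by rewrite -(addKr (b * x1 ^+ 2) (a * _)) E; field.
rewrite E'.
have -> : (D1^-1 + D^-1 - B / b) * y1 * y1 * (a - z) =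
   (D1^-1 + D^-1 - B / b) * y1 ^+ 2 * (a - z) by ring.
by rewrite E'; field; rewrite D0 D10 a0 b0.
Qed.

Lemma lax_step k : step k *m lax k = lax k.+1 *m step k.
Proof.
have vS := vpoly_sqr k; have vS1 := vpoly_sqr k.+1; have vA := vpoly_add k.
have gE := confocal_form_diag k.+1.
have dd : (d k.+1)^-1%:P * (d k.+1)%:P = 1 :> {poly R} by rewrite -polyCM mulVf.
have dm : (d k.+1 / d k)%:P = (d k.+1)%:P * (d k)^-1%:P :> {poly R} by rewrite -polyCM.
have mu0 : 'X - (mu k.+1)%:P != 0 by rewrite polyXsubC_eq0.
rewrite gE in vS vS1; rewrite /step /lax gE dm.
exact: mx2_intertwine dd mu0 vA (etrans vS (esym vS1)).
Qed.

Fixpoint monodromy n := if n is k.+1 then step k *m monodromy k else 1%:M.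

Lemma lax_monodromy n : monodromy n *m lax 0 = lax n *m monodromy n.
Proof.
elim: n => [|n IH]; first by rewrite mul1mx mulmx1.
by rewrite -mulmxA IH !mulmxA lax_step.
Qed.

Lemma monodromy_rec n j :
  ((monodromy n.+1 0 j = ((d n.+1)%:P *
      (((d n.+1)^-1 + (d n)^-1)%:P * 'X - (be n.+1)%:P) * monodromy n 0 j
    - (d n.+1 / d n)%:P * 'X * monodromy n 1 j)%R) *
  (monodromy n.+1 1 j = ('X * monodromy n 0 j)%R))%type.
Proof. by rewrite !mulmx2E !mx2E mul0r addr0 mulNr. Qed.

Lemma monodromy0 : ((monodromy 0 0 0 = 1) * (monodromy 0 0 1 = 0) *
   (monodromy 0 1 0 = 0) * (monodromy 0 1 1 = 1))%type.
Proof. by rewrite !mxE. Qed.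

Lemma monodromy_det n :
  monodromy n 0 0 * monodromy n 1 1 - monodromy n 1 0 * monodromy n 0 1 =
  (d n / d 0)%:P * 'X^(n * 2).
Proof.
elim: n => [|n IH]; first by rewrite !monodromy0 divff // mulr0 subr0 !mulr1.
rewrite !monodromy_rec.
have -> : (d n.+1 / d 0)%:P = (d n.+1 / d n)%:P * (d n / d 0)%:P :> {poly R}.
  by rewrite -polyCM; congr (_%:P); field; rewrite !d0.
rewrite mulSn exprD; transitivity ((d n.+1 / d n)%:P * 'X^2 *
  (monodromy n 0 0 * monodromy n 1 1 - monodromy n 1 0 * monodromy n 0 1)).
  by ring.
by rewrite IH; ring.
Qed.

Lemma size_step_row (p q : {poly R}) (u w c e : R) n :
  (size p <= n.+1)%N -> (size q <= n.+1)%N ->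
  (size (c%:P * (u%:P * 'X - w%:P) * p - e%:P * 'X * q)%R <= n.+2)%N /\
  (c%:P * (u%:P * 'X - w%:P) * p - e%:P * 'X * q)`_n.+1
    = c * u * p`_n - e * q`_n.
Proof.
move=> sp sq; set r := _ - _.
have rE : r = (c * u) *: (p * 'X) - (c * w) *: p - e *: (q * 'X).
  by rewrite /r -!mul_polyC !polyCM; ring.
have ri i : r`_i.+1 = c * u * p`_i - c * w * p`_i.+1 - e * q`_i.
  by rewrite rE !coefB !coefZ !coefMX.
split; last by rewrite ri (nth_default _ sp); ring.
apply/leq_sizeP => [[//|j]] nj; rewrite ri.
have -> : p`_j = 0 by rewrite nth_default ?(leq_trans sp).
have -> : p`_j.+1 = 0 by rewrite nth_default ?(leq_trans sp) ?(leqW nj) // ltnW.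
have -> : q`_j = 0 by rewrite nth_default ?(leq_trans sq).
by ring.
Qed.

Lemma monodromy_size n i j : (size (monodromy n i j) <= n.+1)%N.
Proof.
have H2 (k : 'I_2) :
    (size (monodromy n 0 k)%R <= n.+1)%N /\ (size (monodromy n 1 k)%R <= n.+1)%N.
  elim: n => [|n [IH0 IH1]].
    by split; rewrite mxE; case: eqP => _; rewrite ?size_poly1 ?size_poly0.
  rewrite !monodromy_rec; split; first by have [] := size_step_row
      ((d n.+1)^-1 + (d n)^-1) (be n.+1) (d n.+1) (d n.+1 / d n) IH0 IH1.
  by rewrite mulrC (leq_trans (size_polyMleq _ _)) // size_polyX addn2.
by have [h0 h1] := H2 j; case: (ord2_cases i) => ->.
Qed.

(* The constant sequence solves the recurrence at [x = oo]. *)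
Lemma monodromy_lead n : (monodromy n 0 0)`_n + (monodromy n 0 1)`_n = 1 /\
  (monodromy n 1 0)`_n + (monodromy n 1 1)`_n = 1.
Proof.
elim: n => [|n [IH0 IH1]]; first by rewrite !monodromy0 !coefE /= addr0 add0r.
rewrite !monodromy_rec ![in 'X * _]mulrC !coefMX /=; split; last exact: IH0.
have S j := (size_step_row ((d n.+1)^-1 + (d n)^-1) (be n.+1) (d n.+1)
   (d n.+1 / d n) (monodromy_size n 0 j) (monodromy_size n 1 j)).2.
rewrite !S.
transitivity (d n.+1 * ((d n.+1)^-1 + (d n)^-1) *
    ((monodromy n 0 0)`_n + (monodromy n 0 1)`_n)
  - d n.+1 / d n * ((monodromy n 1 0)`_n + (monodromy n 1 1)`_n)); first by ring.
by rewrite IH0 IH1; field; rewrite !d0.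
Qed.

Lemma vpoly0 k : (v k).[0] = s.
Proof.
rewrite horner_vpoly horner_form !subr0.
have -> : a * b - x k * x k.+1 * b - y k * y k.+1 * a = s * d k.
  by rewrite -(lax_joachimsthal H k); ring.
by field.
Qed.

Lemma form0 k : (g k k).[0] = 0.
Proof. by rewrite confocal_form_diag hornerM hornerX mul0r. Qed.

(** At 0, [vpoly_add] reads 2 s = mu be. *)
Lemma be_neq0 k : be k.+1 != 0.
Proof.
have := congr1 (horner^~ 0) (vpoly_add k).
rewrite /= hornerD !vpoly0 !hornerE => E.
have : s + s != 0 by rewrite -mulr2n mulrn_eq0.
by apply: contra_neq => b0'; rewrite E b0'; ring.
Qed.

(** At 0 only the upper left entry of [step] survives, and it is - d be, which is nonzero. *)
Lemma monodromy_at0 n : (0 < n)%N ->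
  [/\ (monodromy n 0 0).[0] != 0, (monodromy n 0 1).[0] = 0,
  (monodromy n 1 0).[0] = 0 & (monodromy n 1 1).[0] = 0].
Proof.
have H0 : (monodromy n 0 0).[0] != 0 /\ (monodromy n 0 1).[0] = 0.
  elim: n => [|n [IH0 IH1]]; first by rewrite !monodromy0 !hornerE oner_neq0.
  rewrite !monodromy_rec !hornerE IH1; split; last by ring.
  rewrite ?mulr0 ?sub0r ?add0r ?mul0r ?subr0 mulf_neq0 // mulf_neq0 //.
  by rewrite oppr_eq0 be_neq0.
case: n H0 => // n [H0 H1] _.
by split=> //; rewrite !monodromy_rec hornerM hornerX mul0r.
Qed.

(** Iteration of the recurrence encoded by [step] at z = c; each step contributes one factor c. *)
Lemma monodromy_at_root (c : R) (w : nat -> R) n : c != 0 ->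
  (forall k, w k.+2 / d k.+1 + w k / d k =
    ((d k.+1)^-1 + (d k)^-1 - be k.+1 / c) * w k.+1) ->
  (monodromy n 0 0).[c] * w 1%N + (monodromy n 0 1).[c] * w 0%N = c ^+ n * w n.+1 /\
  (monodromy n 1 0).[c] * w 1%N + (monodromy n 1 1).[c] * w 0%N = c ^+ n * w n.
Proof.
move=> c0 rec; elim: n => [|n [IH0 IH1]]; first by rewrite !monodromy0 !hornerE.
rewrite !monodromy_rec !hornerE; split.
  transitivity (d n.+1 * (((d n.+1)^-1 + (d n)^-1) * c - be n.+1) *
     (c ^+ n * w n.+1) - d n.+1 / d n * c * (c ^+ n * w n)).
    by rewrite -IH0 -IH1; ring.
  have -> : w n.+2 = d n.+1 * (w n.+2 / d n.+1 + w n / d n) - d n.+1 / d n * w n.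
    by field; rewrite !d0.
  by rewrite rec exprS; field; rewrite !d0 c0.
by rewrite exprS -mulrA -IH0; ring.
Qed.

End Lax.

(** * Closing of the orbit and the norm equation *)

Section Closing.
Variable R : realFieldType.
Variables (a b l s : R) (x y d be : nat -> R).
Hypothesis H : lax_orbit a b l s x y d be.
Local Notation g := (confocal_form a b x y).
Local Notation v := (vpoly a b x y d).
Local Notation lax := (lax a b x y d).
Local Notation monodromy := (monodromy d be).
Local Notation f := (cubic a b l).

Lemma confocal_formE i j : g i j = 'X^2 - (a + b - x i * x j - y i * y j)%:P * 'X
    + (a * b - x i * x j * b - y i * y j * a)%:P.
Proof.
apply: poly_eq_horner => z.
by rewrite horner_form 2!hornerD hornerN hornerXn hornerM hornerX !hornerC; ring.
Qed.

Lemma size_confocal_form i j : size (g i j) = 3.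
Proof.
rewrite confocal_formE -addrA size_polyDl size_polyXn // -mulNr -polyCN.
apply: leq_ltn_trans (size_polyD _ _) _; rewrite gtn_max size_polyC mul_polyC.
by rewrite (leq_ltn_trans (size_scale_leq _ _)) ?size_polyX //; case: eqP.
Qed.

Lemma size_confocal_formB i j k m : (size (g i j - g k m)%R <= 2)%N.
Proof.
rewrite !confocal_formE; set c := a + b - _ - _; set c' := a + b - _ - _.
set e := a * b - _ - _; set e' := a * b - _ - _.
rewrite (_ : _ - _ = (c' - c)%:P * 'X + (e - e')%:P); last first.
  by rewrite !polyCB; ring.
apply: leq_trans (size_polyD _ _) _; rewrite geq_max size_polyC mul_polyC.
by rewrite (leq_trans (size_scale_leq _ _)) ?size_polyX //; case: eqP.
Qed.

(* [p + q L_k] in matrix form. *)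
Definition lax_lin (p q : {poly R}) k := p%:M + q *: lax k.

Lemma lax_linE p q k :
  ((lax_lin p q k 0 0 = (p + q * v k)%R) *
   (lax_lin p q k 0 1 = (- (q * ((d k)^-1%:P * g k.+1 k.+1)))%R) *
   (lax_lin p q k 1 0 = (q * ((d k)^-1%:P * g k k))%R) *
   (lax_lin p q k 1 1 = (p - q * v k)%R))%type.
Proof. by rewrite !mxE /= !mulr1n !mulr0n !add0r !mulrN. Qed.

Lemma lax_lin_conj p q k :
  lax_lin p q k *m lax_lin p (- q) k = (p ^+ 2 - q ^+ 2 * f)%:M.
Proof.
rewrite -(vpoly_sqr H k).
by apply: eq_mx2; rewrite mulmx2E !lax_linE [RHS]mxE /= ?mulr1n ?mulr0n; ring.
Qed.

Lemma lax_lin_monodromy p q n :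
  lax_lin p q n *m monodromy n = monodromy n *m lax_lin p q 0.
Proof.
rewrite mulmxDl mulmxDr mul_scalar_mx mul_mx_scalar.
by rewrite -scalemxAl -scalemxAr (lax_monodromy H).
Qed.

(** The bottom row sums to p - q (g_(k,k+1) - g_(k,k)) / d_k. The quadratic terms of the two forms
    cancel, so the correction has degree below n. *)
Lemma lax_lin_lead (p q : {poly R}) n k : (size q < n)%N ->
  (lax_lin p q k 1 0)`_n + (lax_lin p q k 1 1)`_n = p`_n.
Proof.
move=> sq; rewrite -coefD !lax_linE.
rewrite (_ : _ + _ = p - (d k)^-1%:P * (q * (g k k.+1 - g k k))); last first.
  by rewrite /vpoly; ring.
rewrite coefB coefCM [X in _ * X]nth_default ?mulr0 ?subr0 //.
apply: leq_trans (size_polyMleq _ _) _; rewrite -subn1 leq_subLR add1n.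
by rewrite (leq_trans (leq_add (leqnn _) (size_confocal_formB _ _ _ _))) // addn2 ltnS.
Qed.

Lemma size_lax_lin (p q : {poly R}) n k i j : (size p <= n.+1)%N -> (size q < n)%N ->
  (size (lax_lin p q k i j) <= n.+1)%N.
Proof.
move=> sp sq.
have sz c i' j' : (size (q * (c%:P * g i' j'))%R <= n.+1)%N.
  rewrite mulrCA mul_polyC (leq_trans (size_scale_leq _ _)) //.
  rewrite (leq_trans (size_polyMleq _ _)) // size_confocal_form.
  by move: sq; clear; lia.
case: (ord2_cases i) => ->; case: (ord2_cases j) => ->;
  rewrite !lax_linE /vpoly ?size_polyN ?sz //.
all: by rewrite (leq_trans (size_polyD _ _)) // geq_max ?size_polyN sp sz.
Qed.

(** With h = p + q L_0 and its conjugate K, the product T = M K is shown to have its bottom row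
    divisible by x^(2n). The degrees then make the bottom row of M a constant combination of the
    rows of h, and it is identified with the bottom row of h. This row suffices to compute the n-th
    vertex. *)
Lemma periodic_of_unit_pell n : (0 < n)%N -> unit_pell a b l s n ->
  x n = x 0%N /\ y n = y 0%N.
Proof.
move=> n0 [p [q [pq pm [sp sq] [ps p0] [pa pb]]]].
set N := (n * 2)%N in pq.
pose h := lax_lin p q 0; pose K := lax_lin p (- q) 0; pose M := monodromy n.
pose T := M *m K.
have hK : K *m h = ('X^N)%:M.
  by have := lax_lin_conj p (- q) 0; rewrite opprK sqrrN pq.
have hK' : h *m K = ('X^N)%:M by rewrite -pq lax_lin_conj.
have Th : T *m h = 'X^N *: M by rewrite -mulmxA hK mul_mx_scalar.
have hT : lax_lin p q n *m T = 'X^N *: M.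
  by rewrite mulmxA lax_lin_monodromy -mulmxA hK' mul_mx_scalar.
have [M00 M01 M10 M11] := monodromy_at0 H n0.
have h00 k : (lax_lin p q k 0 0).[0] != 0.
  rewrite lax_linE hornerD hornerM (vpoly0 H) mulrC -ps -mulr2n.
  by rewrite mulrn_eq0 /= (negPf p0).
have Thj (j : 'I_2) : T 1 0 * h 0 j + T 1 1 * h 1 j = 'X^N * M 1 j.
  by rewrite -mulmx2E Th mxE.
have hT01 : lax_lin p q n 0 0 * T 0 1 + lax_lin p q n 0 1 * T 1 1 = 'X^N * M 0 1.
  by rewrite -mulmx2E hT mxE.
(* Eliminating K 0 1 between the entries of the second column of T leaves det M times K 1 1. *)
have MT : M 0 0 * T 1 1 - M 1 0 * T 0 1 = 'X^N * ((d n / d 0%N)%:P * K 1 1).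
  rewrite mulrA (mulrC 'X^N) -(monodromy_det H) /T !mulmx2E; ring.
have dvT11 : 'X^N %| T 1 1.
  (* [MT] and [hT01] together make T 1 1 times u a multiple of x^(2n); u(0) is nonzero because M 1 0
     vanishes at 0. *)
  pose u := M 0 0 * lax_lin p q n 0 0 + M 1 0 * lax_lin p q n 0 1.
  have : 'X^N %| T 1 1 * u.
    have -> : T 1 1 * u = 'X^N * (lax_lin p q n 0 0 * ((d n / d 0%N)%:P * K 1 1)
        + M 1 0 * M 0 1).
      transitivity (lax_lin p q n 0 0 * ('X^N * ((d n / d 0%N)%:P * K 1 1))
        + M 1 0 * ('X^N * M 0 1)); last by ring.
      by rewrite -MT -hT01 /u; ring.
    exact: dvdp_mulr.
  rewrite Gauss_dvdpl // coprime_expX // /u hornerD !hornerM M10 mul0r addr0.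
  by rewrite mulf_neq0.
have dvT10 : 'X^N %| T 1 0.
  have : 'X^N %| T 1 0 * h 0 0.
    rewrite (_ : _ * _ = 'X^N * M 1 0 - T 1 1 * h 1 0); last by rewrite -Thj; ring.
    by rewrite dvdp_sub // ?dvdp_mulIl // dvdp_mulr.
  by rewrite Gauss_dvdpl // coprime_expX // h00.
have sT (j : 'I_2) : (size (T 1 j)%R <= N.+1)%N.
  have sM1 (i : 'I_2) : (size (M 1 i)%R <= n.+1)%N by exact: monodromy_size.
  have sK i : (size (K i j) <= n.+1)%N by apply: size_lax_lin; rewrite ?sp ?size_polyN.
  have sMK i : (size (M 1 i * K i j)%R <= N.+1)%N.
    apply: leq_trans (size_polyMleq _ _) _.
    have arith u w : (u <= n.+1 -> w <= n.+1 -> (u + w).-1 <= N.+1)%N.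
      by rewrite /N; clear; lia.
    exact: arith (sM1 i) (sK i).
  by rewrite mulmx2E (leq_trans (size_polyD _ _)) // geq_max !sMK.
have T0E := expX_dvdp_const dvT10 (sT 0).
have T1E := expX_dvdp_const dvT11 (sT 1).
set c1 := _`_N in T0E; set c2 := _`_N in T1E.
have XN0 : ('X^N : {poly R}) != 0 by rewrite monic_neq0 // monicXn.
have ME (j : 'I_2) : M 1 j = c1%:P * h 0 j + c2%:P * h 1 j.
  by apply: (mulfI XN0); rewrite -Thj T0E T1E; ring.
(* At 0 the entries M 1 0 and h 1 0 vanish while h 0 0 does not. *)
have c10 : c1 = 0.
  have /(congr1 (horner^~ 0)) := ME 0.
  rewrite /= M10 hornerD !hornerM !hornerC [h 1 0]lax_linE !hornerM (form0 H).
  rewrite !mulr0 addr0 => /esym /eqP; rewrite mulf_eq0 => /orP[/eqP //|].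
  by rewrite (negPf (h00 0%N)).
have M1E (j : 'I_2) : M 1 j = c2%:P * h 1 j by rewrite ME c10 mul0r add0r.
(* The coefficients of x^n in the bottom rows of M and h both sum to 1, since p is monic. *)
have c21 : c2 = 1.
  have [_] := monodromy_lead H n.
  rewrite -/M !M1E !coefCM -mulrDr /h lax_lin_lead // => <-.
  by move: pm; rewrite monicE lead_coefE sp => /eqP ->; rewrite mulr1.
(* The vector (w 1, w 0) is in the kernel of L_0 at c, so p + q L_0 multiplies it by p(c) = c^n,
   while M sends it to c^n (w (n+1), w n). *)
have close (c : R) (w : nat -> R) : c != 0 -> p.[c] = c ^+ n ->
    (v 0%N).[c] * w 0%N = ((d 0%N)^-1%:P * g 0%N 0%N).[c] * w 1%N ->
    (monodromy n 1 0).[c] * w 1%N + (monodromy n 1 1).[c] * w 0%N = c ^+ n * w n ->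
    w n = w 0%N.
  move=> c0 pc wL; rewrite -/M !M1E c21 !mul1r /h !lax_linE => E.
  apply: (mulfI (expf_neq0 n c0)); rewrite -E -pc.
  rewrite hornerM hornerD hornerN [(q * v _).[c]]hornerM mulrBl.
  by rewrite -[_ * _ * w 0%N]mulrA wL; ring.
have a0 := lax_a0 H; have b0 := lax_b0 H.
split.
- apply: (close a) => //; last by have [] := monodromy_at_root H n a0 (lax_recx H).
  by rewrite horner_vpoly !hornerM !hornerC !horner_form; ring.
- apply: (close b) => //; last by have [] := monodromy_at_root H n b0 (lax_recy H).
  by rewrite horner_vpoly !hornerM !hornerC !horner_form; ring.
Qed.

(** M commutes with L_0, so it is p + q L_0 with p and q rational; q is a polynomial once g 1 1
    divides M 0 1. Nonzero x 1 and y 1 allow p(a) and p(b) to be read off from the transported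
    kernels. *)
Lemma unit_pell_of_periodic n : (0 < n)%N ->
  x n = x 0%N -> y n = y 0%N -> x n.+1 = x 1%N -> y n.+1 = y 1%N -> d n = d 0%N ->
  x 1%N != 0 -> y 1%N != 0 -> f.[ell_mu a b x y 1] != 0 ->
  unit_pell a b l s n.
Proof.
move=> n0 xn yn xn1 yn1 dn x1 y1 fmu; pose M := monodromy n.
have d0 := lax_d0 H 0.
have laxn : lax n = lax 0.
  by rewrite /lax /vpoly /confocal_form xn yn xn1 yn1 dn.
have comm : M *m lax 0 = lax 0 *m M by rewrite (lax_monodromy H) laxn.
have i0K : (d 0%N)^-1%:P * (d 0%N)%:P = 1 :> {poly R} by rewrite -polyCM mulVf.
have g1n0 : g 1%N 1%N != 0 by rewrite -size_poly_gt0 size_confocal_form.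
have two : (2%:P : {poly R}) != 0 by rewrite polyC_eq0 pnatr_eq0.
have E01 : 2%:P * (M 0 1 * v 0%N) =
    (d 0%N)^-1%:P * g 1%N 1%N * (M 1 1 - M 0 0).
  have /(congr1 (fun A : 'M[_]_2 => A 0 1)) := comm; rewrite !mulmx2E !mx2E => E.
  apply/eqP; rewrite -subr_eq0; move/eqP: E.
  by rewrite eq_sym -subr_eq0 polyC_natr => /eqP <-; apply/eqP; ring.
have E00 : M 0 1 * g 0%N 0%N = - (g 1%N 1%N * M 1 0).
  have /(congr1 (fun A : 'M[_]_2 => A 0 0)) := comm; rewrite !mulmx2E !mx2E => E.
  have i0 : (d 0%N)^-1%:P != 0 :> {poly R} by rewrite polyC_eq0 invr_eq0.
  apply: (mulfI i0); apply/eqP; rewrite -subr_eq0; move/eqP: E; rewrite -subr_eq0.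
  by move=> /eqP <-; apply/eqP; ring.
(* g 1 1 = x (x - mu) is coprime to v 0: v 0 is s at 0, and at mu its square is f(mu), nonzero by
   assumption. *)
have [q1 q1E] : exists q1, M 0 1 = q1 * g 1%N 1%N.
  apply/dvdpP.
  have : g 1%N 1%N %| M 0 1 * (2%:P * v 0%N).
    by rewrite mulrCA E01 mulrAC dvdp_mull.
  rewrite Gauss_dvdpl // mul_polyC coprimepZr ?pnatr_eq0 //.
  rewrite (confocal_form_diag H) coprimepMl coprimep_sym coprimepX.
  rewrite /root (vpoly0 H) (lax_s0 H) /= coprimep_sym coprimep_XsubC.
  apply: contra fmu => /eqP v0; rewrite -(vpoly_sqr H 0) (confocal_form_diag H 1).
  rewrite hornerD hornerN horner_exp v0 !hornerM hornerXsubC subrr.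
  by rewrite !mulr0 expr0n subrr.
(* q is read off from the upper right entry of p + q L_0, then p from the lower right one. *)
pose q := - ((d 0%N)%:P * q1); pose p := M 1 1 + q * v 0%N.
have ME : M = lax_lin p q 0.
  apply: eq_mx2; rewrite lax_linE.
  - apply: (mulfI (mulf_neq0 g1n0 (_ : (d 0%N)^-1%:P != 0))).
      by rewrite polyC_eq0 invr_eq0.
    move: E01; rewrite q1E /p /q polyC_natr => E01.
    transitivity ((d 0%N)^-1%:P * g 1%N 1%N * M 1 1
      - 2 * (q1 * g 1%N 1%N * v 0%N)); last by ring: i0K.
    by rewrite E01; ring.
  - by rewrite q1E /q; ring: i0K.
  - apply: (mulfI g1n0); rewrite -[LHS]opprK -E00 q1E /q; ring: i0K.
  - by rewrite /p; ring.
have [M00 M01 M10 M11] := monodromy_at0 H n0.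
have sM i j : (size (M i j) <= n.+1)%N by exact: monodromy_size.
have p0 : p.[0] = s * q.[0].
  by rewrite /p hornerD M11 add0r hornerM (vpoly0 H) mulrC.
have sq : (size q < n)%N.
  rewrite /q size_polyN size_Cmul //.
  have [->|q10] := eqVneq q1 0; first by rewrite size_poly0.
  have := sM 0 1; rewrite q1E size_mul // size_confocal_form.
  by rewrite addn3 /= ltnS.
have pn : p`_n = 1.
  by have [_] := monodromy_lead H n; rewrite -/M ME lax_lin_lead.
have sp' : (size p <= n.+1)%N.
  apply: leq_trans (size_polyD _ _) _; rewrite geq_max sM /=.
  rewrite /vpoly mulrCA mul_polyC (leq_trans (size_scale_leq _ _)) //.
  rewrite (leq_trans (size_polyMleq _ _)) // size_confocal_form addn3 /= ltnS.
  exact: sq.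
have sp : size p = n.+1.
  apply/eqP; rewrite eqn_leq sp' ltnNge; apply/negP => spn.
  by move: pn; rewrite nth_default // => /eqP; rewrite eq_sym oner_eq0.
clearbody p q; have at_root (c : R) (w : nat -> R) : w 1%N != 0 -> w n.+1 = w 1%N ->
    (v 0%N).[c] * w 1%N = ((d 0%N)^-1%:P * g 1%N 1%N).[c] * w 0%N ->
    (monodromy n 0 0).[c] * w 1%N + (monodromy n 0 1).[c] * w 0%N = c ^+ n * w n.+1 ->
    p.[c] = c ^+ n.
  move=> w1 -> wL; rewrite -/M ME !lax_linE => E.
  apply: (mulIf w1); rewrite -E hornerD hornerN [(q * v _).[c]]hornerM.
  rewrite [(q * (_ * _)).[c]]hornerM mulrDl -[_ * _ * w 1%N]mulrA wL; ring.
exists p, q; split => //.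
- have := monodromy_det H n; rewrite -/M ME !lax_linE dn divff // mul1r => <-.
  by rewrite -(vpoly_sqr H 0); ring.
- by rewrite monicE lead_coefE sp pn.
- split=> //; apply: contra_neq M00 => pz.
  rewrite -/M ME lax_linE hornerD hornerM (vpoly0 H) mulrC -p0 pz.
  by rewrite addr0.
split.
- apply: (at_root _ x) => //; last first.
    by have [] := monodromy_at_root H n (lax_a0 H) (lax_recx H).
  by rewrite horner_vpoly !hornerM !hornerC !horner_form; ring.
- apply: (at_root _ y) => //; last first.
    by have [] := monodromy_at_root H n (lax_b0 H) (lax_recy H).
  by rewrite horner_vpoly !hornerM !hornerC !horner_form; ring.
Qed.

End Closing.

(** * Geometry of the billiard: tangency, reflection, existence of trajectories *)

Section Geometry.
Variables (R : realType) (a b l : R).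
Hypotheses (hb : 0 < b) (ha : 0 < a) (hl : 0 < l) (hal : a - l != 0) (hbl : b - l != 0).
Implicit Types (P Q N u v : R * R) (p : nat -> R * R).

Let a0 : a != 0. Proof. by rewrite gt_eqF. Qed.
Let b0 : b != 0. Proof. by rewrite gt_eqF. Qed.

(** The dual conic of C_l evaluated at the coordinates (dy, - dx, P x Q) of the line through P and
    Q. *)
Definition caustic_eq P Q : Prop :=
  a * (Q.2 - P.2) ^+ 2 + b * (Q.1 - P.1) ^+ 2 - (P.1 * Q.2 - P.2 * Q.1) ^+ 2
  = l * ((Q.1 - P.1) ^+ 2 + (Q.2 - P.2) ^+ 2).

Lemma on_ellipseP P : on_ellipse a b P <-> b * P.1 ^+ 2 + a * P.2 ^+ 2 = a * b.
Proof.
have ab0 : a * b != 0 by rewrite mulf_neq0.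
have -> : b * P.1 ^+ 2 + a * P.2 ^+ 2 = (P.1 ^+ 2 / a + P.2 ^+ 2 / b) * (a * b).
  by field; rewrite a0 b0.
by split=> [->|E]; [rewrite mul1r | apply: (mulIf ab0); rewrite mul1r].
Qed.

Lemma sumsq_gt0 (x y : R) : (x, y) <> (0, 0) -> 0 < x ^+ 2 + y ^+ 2.
Proof.
move=> xy; rewrite lt0r addr_ge0 ?sqr_ge0 // andbT paddr_eq0 ?sqr_ge0 //.
rewrite !sqrf_eq0; apply/negP => /andP[/eqP x0 /eqP y0].
by apply: xy; rewrite x0 y0.
Qed.

Lemma chord_neq P Q : P <> Q -> (Q.1 - P.1, Q.2 - P.2) <> (0, 0).
Proof.
case: P Q => x y [x' y'] /= PQ [] /eqP; rewrite subr_eq0 => /eqP xx /eqP.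
by rewrite subr_eq0 => /eqP yy; apply: PQ; rewrite xx yy.
Qed.

Lemma tangent_line_caustic P Q : P <> Q ->
  tangent_line a b l P Q <-> caustic_eq P Q.
Proof.
move=> PQ; have := sumsq_gt0 (chord_neq PQ); set D := _ + _ => D0.
split=> [[X [Y [Z [nz XYZ EP EQ]]]]|E].
  set u := X / (a - l); set v := Y / (b - l).
  have uX : X = u * (a - l) by rewrite /u; field.
  have vY : Y = v * (b - l) by rewrite /v; field.
  have {}EP : u * P.1 + v * P.2 = Z by rewrite -EP /u /v; field; rewrite hal hbl.
  have {}EQ : u * Q.1 + v * Q.2 = Z by rewrite -EQ /u /v; field; rewrite hal hbl.
  have {}XYZ : (a - l) * u ^+ 2 + (b - l) * v ^+ 2 = Z ^+ 2.
    by rewrite -XYZ /u /v; field; rewrite hal hbl.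
  have orth : u * (Q.1 - P.1) + v * (Q.2 - P.2) = 0.
    by apply: (addIr (u * P.1 + v * P.2)); rewrite add0r {2}EP -EQ; ring.
  (* (u, v) is orthogonal to the chord, hence t times its normal (dy, - dx). *)
  pose t := (u * (Q.2 - P.2) - v * (Q.1 - P.1)) / D.
  have D00 : D != 0 by rewrite gt_eqF.
  have ut : u = t * (Q.2 - P.2).
    apply: (mulIf D00).
    transitivity ((u * (Q.2 - P.2) - v * (Q.1 - P.1)) * (Q.2 - P.2)
      + (u * (Q.1 - P.1) + v * (Q.2 - P.2)) * (Q.1 - P.1)); first by rewrite /D; ring.
    by rewrite orth /t; field.
  have vt : v = - t * (Q.1 - P.1).
    apply: (mulIf D00).
    transitivity (- (u * (Q.2 - P.2) - v * (Q.1 - P.1)) * (Q.1 - P.1)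
      + (u * (Q.1 - P.1) + v * (Q.2 - P.2)) * (Q.2 - P.2)); first by rewrite /D; ring.
    by rewrite orth /t; field.
  have t0 : t != 0.
    apply/eqP => t0; apply: nz; rewrite uX vY -EP ut vt t0.
    by congr (_, _, _); ring.
  apply: (mulfI (expf_neq0 2 t0)).
  have Zt : Z = t * (P.1 * Q.2 - P.2 * Q.1) by rewrite -EP ut vt; ring.
  apply/eqP; rewrite -subr_eq0; apply/eqP.
  transitivity ((a - l) * u ^+ 2 + (b - l) * v ^+ 2 - Z ^+ 2).
    by rewrite ut vt Zt; ring.
  by rewrite XYZ subrr.
(* The point of contact is the pole of the line with respect to C_l. *)
exists ((a - l) * (Q.2 - P.2)), (- (b - l) * (Q.1 - P.1)), (P.1 * Q.2 - P.2 * Q.1).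
split.
- case=> /eqP; rewrite mulf_eq0 (negPf hal) => /= /eqP y0 /eqP.
  rewrite mulf_eq0 oppr_eq0 (negPf hbl) => /= /eqP x0 _.
  by move: D0; rewrite /D /= x0 y0 expr0n addr0 ltxx.
- transitivity (a * (Q.2 - P.2) ^+ 2 + b * (Q.1 - P.1) ^+ 2
    - l * ((Q.1 - P.1) ^+ 2 + (Q.2 - P.2) ^+ 2)).
    by field; rewrite hal hbl.
  by rewrite -E; ring.
- by field; rewrite hal hbl.
- by field; rewrite hal hbl.
Qed.

(** Joachimsthal's quantity: for Q on the ellipse it is a b times the product of Q - P with the
    normal at Q. *)
Definition joach P Q : R := a * b - b * (P.1 * Q.1) - a * (P.2 * Q.2).

(** Lagrange's identity for the form b x^2 + a y^2. Tangency to C_l thus means that the square of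
    [joach] is a b l times the squared chord length. *)
Lemma joach_sqr P Q : on_ellipse a b P -> on_ellipse a b Q ->
  joach P Q ^+ 2 = a * b * (a * (Q.2 - P.2) ^+ 2 + b * (Q.1 - P.1) ^+ 2
    - (P.1 * Q.2 - P.2 * Q.1) ^+ 2).
Proof.
move=> /on_ellipseP EP /on_ellipseP EQ; pose w := b * (P.1 * Q.1) + a * (P.2 * Q.2).
have cE : a * b * (P.1 * Q.2 - P.2 * Q.1) ^+ 2 = (a * b) * (a * b) - w ^+ 2.
  transitivity ((b * P.1 ^+ 2 + a * P.2 ^+ 2) * (b * Q.1 ^+ 2 + a * Q.2 ^+ 2) - w ^+ 2).
    by rewrite /w; ring.
  by rewrite EP EQ.
have sE : a * (Q.2 - P.2) ^+ 2 + b * (Q.1 - P.1) ^+ 2 = a * b + a * b - 2 * w.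
  transitivity ((b * P.1 ^+ 2 + a * P.2 ^+ 2) + (b * Q.1 ^+ 2 + a * Q.2 ^+ 2) - 2 * w).
    by rewrite /w; ring.
  by rewrite EP EQ.
have -> : joach P Q = a * b - w by rewrite /joach /w; ring.
by rewrite mulrBr cE sE; ring.
Qed.

Lemma joach_half P Q : on_ellipse a b P -> on_ellipse a b Q ->
  joach P Q = (b * (Q.1 - P.1) ^+ 2 + a * (Q.2 - P.2) ^+ 2) / 2.
Proof.
move=> /on_ellipseP EP /on_ellipseP EQ; apply: (mulIf (_ : 2 != 0)).
  by rewrite pnatr_eq0.
rewrite divfK ?pnatr_eq0 // /joach.
transitivity ((a * b) + (a * b) - 2 * (b * (P.1 * Q.1) + a * (P.2 * Q.2))).
  by ring.
by rewrite -{1}EP -EQ; ring.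
Qed.

Lemma joach_gt0 P Q : on_ellipse a b P -> on_ellipse a b Q -> P <> Q ->
  0 < joach P Q.
Proof.
move=> EP EQ PQ; rewrite joach_half // divr_gt0 //.
have x0 : 0 <= b * (Q.1 - P.1) ^+ 2 by rewrite mulr_ge0 ?sqr_ge0 ?ltW.
have y0 : 0 <= a * (Q.2 - P.2) ^+ 2 by rewrite mulr_ge0 ?sqr_ge0 ?ltW.
rewrite lt0r addr_ge0 // andbT paddr_eq0 //.
rewrite (mulf_eq0 b) (mulf_eq0 a) !sqrf_eq0 (negPf a0) (negPf b0) /=.
apply/negP => /andP[/eqP {}x0 /eqP {}y0].
by apply: (chord_neq PQ); rewrite x0 y0.
Qed.

Lemma enorm_sqr u : enorm u ^+ 2 = u.1 ^+ 2 + u.2 ^+ 2.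
Proof. by rewrite sqr_sqrtr /dot -!expr2 // addr_ge0 // sqr_ge0. Qed.

Lemma enorm_gt0 u : u <> 0 -> 0 < enorm u.
Proof.
by case: u => x y u0; rewrite sqrtr_gt0 /dot /= -!expr2; apply: sumsq_gt0.
Qed.

Lemma ellipse_normal_neq0 Q : on_ellipse a b Q -> ellipse_normal a b Q <> 0.
Proof.
move=> /on_ellipseP EQ [/eqP + /eqP]; rewrite !mulf_eq0 !invr_eq0 (negPf a0) (negPf b0).
rewrite !orbF => /eqP x0 /eqP y0; move: EQ.
rewrite x0 y0 expr0n !mulr0 addr0 => /esym /eqP.
by rewrite mulf_eq0 (negPf a0) (negPf b0).
Qed.

(* The reflection law says that the sum of the two unit vectors leaving [Q] is
   normal to the ellipse. *)
Lemma reflection_lawP P Q P' : on_ellipse a b Q -> P <> Q -> P' <> Q ->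
  reflection_law a b P Q P' ->
  let c := - (dot (ellipse_normal a b Q) (P - Q) / enorm (P - Q)
     + dot (ellipse_normal a b Q) (P' - Q) / enorm (P' - Q))
       / dot (ellipse_normal a b Q) (ellipse_normal a b Q) in
  (P.1 - Q.1) / enorm (P - Q) + (P'.1 - Q.1) / enorm (P' - Q) = - c * (Q.1 / a) /\
  (P.2 - Q.2) / enorm (P - Q) + (P'.2 - Q.2) / enorm (P' - Q) = - c * (Q.2 / b).
Proof.
move=> EQ PQ PQ'; rewrite /reflection_law /cos_angle /sin_angle.
have := ellipse_normal_neq0 EQ; set N := ellipse_normal a b Q => N0.
have n0 : enorm N != 0 by rewrite gt_eqF // enorm_gt0.
have NN : dot N N != 0.
  by rewrite /dot -!expr2 -enorm_sqr expf_neq0.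
have d0 : enorm (P - Q) != 0.
  by rewrite gt_eqF // enorm_gt0 // => /eqP; rewrite subr_eq0 => /eqP.
have d1 : enorm (P' - Q) != 0.
  by rewrite gt_eqF // enorm_gt0 // => /eqP; rewrite subr_eq0 => /eqP.
rewrite -[P.1 - Q.1]/((P - Q).1) -[P.2 - Q.2]/((P - Q).2).
rewrite -[P'.1 - Q.1]/((P' - Q).1) -[P'.2 - Q.2]/((P' - Q).2).
rewrite -[Q.1 / a]/(N.1) -[Q.2 / b]/(N.2).
move: N (P - Q) (P' - Q) {N0} n0 NN d0 d1 => N u u'.
move: (enorm N) (enorm u) (enorm u') => n d d' n0 NN d0 d1 [_ S].
have {}S : cross N u / d + cross N u' / d' = 0.
  apply: (mulIf (invr_neq0 n0)); rewrite mul0r mulrDl.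
  have -> : cross N u / d / n = cross N u / (n * d) by field; rewrite n0 d0.
  by rewrite S; field; rewrite n0 d1.
split; apply: (mulIf NN); apply/eqP; rewrite -subr_eq0; apply/eqP.
- transitivity (- N.2 * (cross N u / d + cross N u' / d')).
    by move: NN; rewrite /dot /cross => NN; field; rewrite NN d0 d1.
  by rewrite S mulr0.
- transitivity (N.1 * (cross N u / d + cross N u' / d')).
    by move: NN; rewrite /dot /cross => NN; field; rewrite NN d0 d1.
  by rewrite S mulr0.
Qed.

Lemma lax_orbit_of_trajectory p :
  billiard_trajectory a b p -> has_caustic a b l p ->
  exists be, lax_orbit a b l (Num.sqrt (a * b * l)) (fun k => (p k).1)
    (fun k => (p k).2) (fun k => enorm (p k.+1 - p k)) be.
Proof.
move=> [pE pN pR] pC.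
have abl : 0 < a * b * l by rewrite !mulr_gt0.
have d0 k : 0 < enorm (p k.+1 - p k).
  by apply: enorm_gt0 => /eqP; rewrite subr_eq0 => /eqP /esym /pN.
have dN k : enorm (p k - p k.+1) = enorm (p k.+1 - p k).
  by rewrite /enorm /dot /= -!expr2 -!(opprB (p k.+1).1) -!(opprB (p k.+1).2) !sqrrN.
have pC' k : caustic_eq (p k) (p k.+1) by
  apply/tangent_line_caustic; [exact: pN|exact: pC].
have rec k := reflection_lawP (pE k.+1) (@pN k) (fun e => @pN k.+1 (esym e)) (pR k).
pose N k := ellipse_normal a b (p k).
(* The predecessor is meaningful because [lax_orbit] only uses [be] at successors. *)
exists (fun k => - (dot (N k) (p k.-1 - p k) / enorm (p k.-1 - p k)
     + dot (N k) (p k.+1 - p k) / enorm (p k.+1 - p k)) / dot (N k) (N k)).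
split=> // [|k|k|k|k|k|k|k].
- by rewrite gt_eqF // sqrtr_gt0.
- exact/on_ellipseP/pE.
- by rewrite gt_eqF.
- by rewrite enorm_sqr.
- by rewrite enorm_sqr; apply: pC'.
(* Both sides are nonnegative, so it suffices to compare their squares. *)
- rewrite -/(joach (p k) (p k.+1)); apply/eqP; rewrite eq_sym.
  rewrite -(eqrXn2 (n := 2)) ?mulr_ge0 ?sqrtr_ge0 //; last first.
    by rewrite ltW // joach_gt0 //; exact: pN.
  by rewrite joach_sqr // pC' exprMn sqr_sqrtr ?ltW // enorm_sqr; apply/eqP; ring.
- have [/= + _] := rec k; rewrite dN /N; set c := _ / dot _ _ => E.
  rewrite mulrBl; transitivity ((((p k).1 - (p k.+1).1) / enorm (p k.+1 - p k)
    + ((p k.+2).1 - (p k.+1).1) / enorm (p k.+2 - p k.+1))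
    + ((enorm (p k.+2 - p k.+1))^-1 + (enorm (p k.+1 - p k))^-1) * (p k.+1).1).
    by ring.
  by rewrite E; ring.
- have [/= _ +] := rec k; rewrite dN /N; set c := _ / dot _ _ => E.
  rewrite mulrBl; transitivity ((((p k).2 - (p k.+1).2) / enorm (p k.+1 - p k)
    + ((p k.+2).2 - (p k.+1).2) / enorm (p k.+2 - p k.+1))
    + ((enorm (p k.+2 - p k.+1))^-1 + (enorm (p k.+1 - p k))^-1) * (p k.+1).2).
    by ring.
  by rewrite E; ring.
Qed.

Definition reflect_dir P Q : R * R :=
  let N := ellipse_normal a b Q in
  (Q - P) - (2 * dot N (Q - P) / dot N N) *: (N : R^o * R^o).

(** The nonzero root t of the equation placing Q + t w on the ellipse. *)
Definition reflect_time P Q : R :=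
  let w := reflect_dir P Q in
  - 2 * dot (ellipse_normal a b Q) w / (w.1 ^+ 2 / a + w.2 ^+ 2 / b).

Definition reflect P Q : R * R :=
  (Q.1 + reflect_time P Q * (reflect_dir P Q).1,
   Q.2 + reflect_time P Q * (reflect_dir P Q).2).

(** Reflection keeps the length of the direction and reverses its normal component, so [joach] and
    the chord length are both multiplied by t; by [joach_sqr] the caustic is preserved. *)
Lemma reflectP P Q : on_ellipse a b P -> on_ellipse a b Q -> P <> Q ->
  caustic_eq P Q ->
  [/\ on_ellipse a b (reflect P Q), Q <> reflect P Q,
      reflection_law a b P Q (reflect P Q) & caustic_eq Q (reflect P Q)].
Proof.
move=> EP EQ PQ CPQ.
pose N := ellipse_normal a b Q; pose u := Q - P; pose w := reflect_dir P Q.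
pose t := reflect_time P Q; pose P' := reflect P Q.
have ab0 : a * b != 0 by rewrite mulf_neq0.
have NN : dot N N != 0.
  by rewrite /dot -!expr2 -enorm_sqr expf_neq0 // gt_eqF // enorm_gt0 //;
    exact: ellipse_normal_neq0.
have n0 : enorm N != 0 by rewrite gt_eqF // enorm_gt0 //; exact: ellipse_normal_neq0.
have w1 : w.1 = u.1 - 2 * dot N u / dot N N * N.1 by [].
have w2 : w.2 = u.2 - 2 * dot N u / dot N N * N.2 by [].
have Nw : dot N w = - dot N u.
  rewrite {1}/dot w1 w2; move: NN; rewrite {2 4}/dot /dot => NN; field; exact: NN.
have Cw : cross N w = cross N u by rewrite /cross w1 w2; ring.
have ww : w.1 ^+ 2 + w.2 ^+ 2 = u.1 ^+ 2 + u.2 ^+ 2.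
  by rewrite w1 w2; move: NN; rewrite /dot => NN; field; exact: NN.
have hNu : dot N u = joach P Q / (a * b).
  have /on_ellipseP E := EQ; rewrite /dot /joach -{1}E /N /u /=; field.
  by rewrite a0 b0.
have Nu0 : 0 < dot N u by rewrite hNu divr_gt0 ?mulr_gt0 // joach_gt0.
have uu : 0 < u.1 ^+ 2 + u.2 ^+ 2 by apply: sumsq_gt0; exact: chord_neq.
have wab : 0 < w.1 ^+ 2 / a + w.2 ^+ 2 / b.
  have w0 : 0 <= w.1 ^+ 2 / a by rewrite mulr_ge0 ?sqr_ge0 // invr_ge0 ltW.
  have w0' : 0 <= w.2 ^+ 2 / b by rewrite mulr_ge0 ?sqr_ge0 // invr_ge0 ltW.
  rewrite lt0r addr_ge0 // andbT paddr_eq0 // !(mulf_eq0 (_ ^+ 2)) !invr_eq0.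
  rewrite (negPf a0) (negPf b0) !orbF !sqrf_eq0; apply/negP => /andP[/eqP z1 /eqP z2].
  by move: uu; rewrite -ww z1 z2 expr0n addr0 ltxx.
have tE : t = 2 * dot N u / (w.1 ^+ 2 / a + w.2 ^+ 2 / b).
  by rewrite /t /reflect_time -/N -/w Nw; ring.
have t0 : 0 < t by rewrite tE divr_gt0 // mulr_gt0.
have P'1 : P'.1 = Q.1 + t * w.1 by [].
have P'2 : P'.2 = Q.2 + t * w.2 by [].
have EP' : on_ellipse a b P'.
  rewrite /on_ellipse -EQ P'1 P'2.
  transitivity (Q.1 ^+ 2 / a + Q.2 ^+ 2 / b
    + t * (2 * dot N w + t * (w.1 ^+ 2 / a + w.2 ^+ 2 / b))).
    by rewrite /dot /N /=; field; rewrite a0 b0.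
  have tD : t * (w.1 ^+ 2 / a + w.2 ^+ 2 / b) = 2 * dot N u.
    by rewrite tE divfK ?gt_eqF.
  by rewrite Nw tD; ring.
have dE : P' - Q = (t * w.1, t * w.2).
  by rewrite [P']surjective_pairing P'1 P'2; congr (_, _) => /=; ring.
have u0 : 0 < enorm u.
  by rewrite sqrtr_gt0 /dot -!expr2.
have te0 : 0 <= t * enorm u by apply: mulr_ge0; rewrite ltW.
have eP' : enorm (P' - Q) = t * enorm u.
  apply/eqP; rewrite -(eqrXn2 (n := 2)) ?te0 ?sqrtr_ge0 //.
  rewrite exprMn !enorm_sqr dE -ww; apply/eqP.
  by rewrite -[LHS]/((t * w.1) ^+ 2 + (t * w.2) ^+ 2); ring.
have QP' : Q <> P'.
  move=> E; have : (t * enorm u) ^+ 2 = 0.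
    by rewrite -eP' -E subrr enorm_sqr /= expr0n addr0.
  by move/eqP; rewrite sqrf_eq0 mulf_eq0 !gt_eqF.
have dPQ : enorm (P - Q) = enorm u.
  by rewrite /enorm /dot /u /= -!expr2 -!(opprB Q.1) -!(opprB Q.2) !sqrrN.
split=> //.
  have dNt : dot N (t * w.1, t * w.2) = - t * dot N u.
    rewrite mulNr -mulrN -Nw.
    by rewrite -[LHS]/(N.1 * (t * w.1) + N.2 * (t * w.2)) /dot; ring.
  have cNt : cross N (t * w.1, t * w.2) = t * cross N u.
    rewrite -Cw -[LHS]/(N.1 * (t * w.2) - N.2 * (t * w.1)) /cross; ring.
  have dNu : dot N (- u) = - dot N u.
    by rewrite -[LHS]/(N.1 * - u.1 + N.2 * - u.2) /dot; ring.
  have cNu : cross N (- u) = - cross N u.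
    by rewrite -[LHS]/(N.1 * - u.2 - N.2 * - u.1) /cross; ring.
  rewrite /reflection_law /cos_angle /sin_angle -/N -/P' eP' dPQ dE.
  rewrite -(opprB Q P) -/u dNt cNt dNu cNu.
  by split; field; rewrite n0 !gt_eqF.
apply: (mulfI ab0); rewrite -(joach_sqr EQ EP').
have h' : joach Q P' = t * joach P Q.
  have {1}-> : joach P Q = a * b * dot N u by rewrite hNu; field; rewrite a0 b0.
  have /on_ellipseP E := EQ.
  have -> : dot N u = - dot N w by rewrite Nw opprK.
  by rewrite /joach P'1 P'2 -{1}E /dot /N /=; field; rewrite a0 b0.
rewrite h' exprMn joach_sqr // CPQ P'1 P'2.
transitivity (a * b * l * (t ^+ 2 * (w.1 ^+ 2 + w.2 ^+ 2))); last by ring.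
by rewrite ww /u /=; ring.
Qed.

Fixpoint bounces P Q k : (R * R) * (R * R) :=
  if k is j.+1 then let: (P', Q') := bounces P Q j in (Q', reflect P' Q')
  else (P, Q).

Lemma trajectory_exists P Q : on_ellipse a b P -> on_ellipse a b Q -> P <> Q ->
  caustic_eq P Q -> exists p, [/\ billiard_trajectory a b p, has_caustic a b l p,
    p 0%N = P & p 1%N = Q].
Proof.
move=> EP EQ PQ CPQ; pose st := bounces P Q.
have S k : st k.+1 = ((st k).2, reflect (st k).1 (st k).2).
  by rewrite /st /=; case: bounces.
have inv k : [/\ on_ellipse a b (st k).1, on_ellipse a b (st k).2,
    (st k).1 <> (st k).2 & caustic_eq (st k).1 (st k).2].
  elim: k => [//|k [E1 E2 E12 C]]; rewrite S /=.
  by have [] := reflectP E1 E2 E12 C.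
exists (fun k => (st k).1).
have S1 k : (st k.+1).1 = (st k).2 by rewrite S.
split=> //.
  split=> k; have [E1 E2 E12 C] := inv k; rewrite ?S1 //.
  by rewrite [(st k.+1).2](congr1 snd (S k)) /=; have [] := reflectP E1 E2 E12 C.
by move=> k; have [E1 E2 E12 C] := inv k; rewrite S1; apply/tangent_line_caustic.
Qed.

(* The tangent to the caustic at its vertex on the x-axis is always a chord of
   the ellipse. *)
Lemma vertical_trajectory : l < a -> exists p (x y : R),
  [/\ billiard_trajectory a b p, has_caustic a b l p, p 0%N = (x, - y), p 1%N = (x, y)
    & [/\ x ^+ 2 = a - l, y ^+ 2 = b * l / a, x != 0 & y != 0]].
Proof.
move=> la; pose x := Num.sqrt (a - l); pose y := Num.sqrt (b * l / a).
have x2 : x ^+ 2 = a - l by rewrite sqr_sqrtr // subr_ge0 ltW.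
have y2 : y ^+ 2 = b * l / a by rewrite sqr_sqrtr // divr_ge0 ?mulr_ge0 ?ltW.
have x0 : x != 0 by rewrite gt_eqF // sqrtr_gt0 subr_gt0.
have y0 : y != 0 by rewrite gt_eqF // sqrtr_gt0 divr_gt0 // mulr_gt0.
have E : forall z, z ^+ 2 = y ^+ 2 -> on_ellipse a b (x, z).
  by move=> z z2; apply/on_ellipseP; rewrite /= z2 x2 y2; field.
have [] := @trajectory_exists (x, - y) (x, y).
- by apply: E; rewrite sqrrN.
- exact: E.
- case=> /eqP; rewrite -subr_eq0 -opprD oppr_eq0 -mulr2n mulrn_eq0 /=.
  exact/negP.
- rewrite /caustic_eq /=; transitivity (4 * y ^+ 2 * (a - x ^+ 2)); first by ring.
  by rewrite x2; ring.
by move=> p [pb pc p0 p1]; exists p, x, y.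
Qed.

End Geometry.

(** * Periodicity as a Pell equation, and the determinants *)

Section Caustic.
Variables (R : realType) (a b l : R).
Hypotheses (hb : 0 < b) (hab : b < a) (hl : 0 < l) (hla : l < a) (hlb : l != b).

Let ha : 0 < a := lt_trans hb hab.
Let hal : a - l != 0. Proof. by rewrite subr_eq0 gt_eqF. Qed.
Let hbl : b - l != 0. Proof. by rewrite subr_eq0 eq_sym. Qed.

Local Notation s := (Num.sqrt (a * b * l)).

(** One well-chosen trajectory, starting with a vertical chord, yields the Pell solution. This
    solution closes every trajectory, and closing at an arbitrary index follows by shifting the
    sequence. *)
Lemma trajectories_periodicP n : (0 < n)%N ->
  trajectories_periodic a b l n <-> unit_pell a b l s n.
Proof.
move=> n0; split=> [per|up p tr ca k].
  have [p [x [y [tr ca p0 p1 [x2 y2 x0 y0]]]]] :=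
    vertical_trajectory hb ha hl hal hbl hla.
  have [be L] := lax_orbit_of_trajectory hb ha hl hal hbl tr ca.
  have pn : p n = p 0%N by rewrite -(per p tr ca 0%N).
  have pn1 : p n.+1 = p 1%N by rewrite -(per p tr ca 1%N).
  apply: (unit_pell_of_periodic L) => //=; rewrite ?pn ?pn1 ?p1 //.
  rewrite horner_cubic /ell_mu p1 /= x2 y2.
  have a0 : a != 0 by rewrite gt_eqF.
  (* Here mu = b + l - b l / a, and each factor of f(mu) is a product of nonzero terms. *)
  have -> : (a - (a + b - (a - l) - b * l / a)) * (b - (a + b - (a - l) - b * l / a)) *
    (l - (a + b - (a - l) - b * l / a)) =
    ((a - b) * (a - l) / a) * (- l * (a - b) / a) * (- b * (a - l) / a).
    by field.
  have ab : a - b != 0 by rewrite subr_eq0 gt_eqF.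
  have l0 : - l != 0 by rewrite oppr_eq0 gt_eqF.
  have b0 : - b != 0 by rewrite oppr_eq0 gt_eqF.
  by rewrite !mulf_neq0 ?invr_neq0.
pose q j := p (k + j)%N.
have trq : billiard_trajectory a b q.
  by case: tr => t1 t2 t3; split=> j; rewrite /q ?addnS;
    [exact: t1|exact: t2|exact: t3].
have caq : has_caustic a b l q by move=> j; rewrite /q addnS; exact: ca.
have [be L] := lax_orbit_of_trajectory hb ha hl hal hbl trq caq.
have [/= q1 q2] := periodic_of_unit_pell L n0 up.
by rewrite -/(q n) [q n]surjective_pairing q1 q2 -surjective_pairing /q addn0.
Qed.

Lemma size_subCX (c : R) : size (c%:P - 'X : {poly R}) = 2.
Proof. by rewrite -opprB size_polyN size_XsubC. Qed.

Lemma subCX_neq0 (c : R) : (c%:P - 'X : {poly R}) != 0.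
Proof. by rewrite -size_poly_gt0 size_subCX. Qed.

Lemma size_mul_subCX (p : {poly R}) (c : R) : p != 0 ->
  size (p * (c%:P - 'X)) = (size p).+1.
Proof. by move=> p0; rewrite size_mul ?subCX_neq0 // size_subCX addn2. Qed.

Lemma size_subCX2 (c c' : R) : size ((c%:P - 'X) * (c'%:P - 'X) : {poly R}) = 3.
Proof. by rewrite size_mul_subCX ?subCX_neq0 // size_subCX. Qed.

Lemma size_cubic : size (cubic a b l) = 4.
Proof. by rewrite size_mul_subCX ?mulf_neq0 ?subCX_neq0 // size_subCX2. Qed.

Lemma size_sqr_mul (P f : {poly R}) d n k : size f = d.+1 ->
  (forall j, (j.*2 + d <= n) = (j <= k))%N ->
  (size (P ^+ 2 * f)%R <= n.+1)%N = (size P <= k.+1)%N.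
Proof.
move=> sf H; have [->|P0] := eqVneq P 0; first by rewrite expr0n mul0r size_poly0.
have f0 : f != 0 by rewrite -size_poly_gt0 sf.
rewrite expr2 !size_mul ?mulf_neq0 // sf.
move: P0; rewrite -size_poly_gt0; case: (size P) => [//|j] _.
have -> : (((j.+1 + j.+1).-1 + d.+1).-1 = (j.*2 + d).+1)%N by clear; lia.
by rewrite !ltnS H.
Qed.

Let f_gt0 : 0 < ((a%:P - 'X) * (b%:P - 'X) * (l%:P - 'X) : {poly R}).[0].
Proof. by rewrite !hornerE !subr0 !mulr_gt0. Qed.

Let fE : (fun x : R => Num.sqrt ((a - x) * (b - x) * (l - x))) =
  (fun x => Num.sqrt ((a%:P - 'X) * (b%:P - 'X) * (l%:P - 'X)).[x]).
Proof. by apply/funext => x; rewrite -/(cubic a b l) horner_cubic. Qed.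

Let s0 : s != 0. Proof. by rewrite gt_eqF // sqrtr_gt0 !mulr_gt0. Qed.
Let s2 : s ^+ 2 = a * b * l. Proof. by rewrite sqr_sqrtr // ltW // !mulr_gt0. Qed.

Lemma taylor_coef0 (h : R -> R) : taylor_coef h 0 = h 0.
Proof. by rewrite /taylor_coef derive1n0 divr1. Qed.

(** Here S^2 (l - x) = (a - x)(b - x) for S = sqrt f / (l - x). The bounds are deg P <= m and deg Q
    <= m - 1: an m by m matrix with index shift 2. *)
Lemma pell_odd m : (0 < m)%N ->
  pell_solvable (l%:P - 'X) ((a%:P - 'X) * (b%:P - 'X)) (2 * m + 1) <->
  \det (\matrix_(i < m, j < m) Ccoef a b l (i.+1 + j.+1)%N) = 0.
Proof.
move=> m0; have -> : \matrix_(i < m, j < m) Ccoef a b l (i.+1 + j.+1)%N =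
   \matrix_(i < m, j < m) Ccoef a b l (i + j + 2)%N.
  by apply/matrixP => i j; rewrite !mxE addSn addnS addn2.
apply: (@pell_solvable_hankel _ _ _ (Ccoef a b l) _ m).
- by rewrite addn2 prednK.
- by clear -m0; lia.
- by rewrite mulrC size_cubic.
- by rewrite hornerD hornerN hornerC hornerX subr0 gt_eqF.
- by rewrite /Ccoef taylor_coef0 !subr0 mulf_neq0 // invr_neq0 // gt_eqF.
- by move=> P; rewrite (@size_sqr_mul _ _ 1 _ m) ?size_subCX // => j; lia.
- move=> Q; rewrite addn1 -{2}(prednK m0).
  by rewrite (@size_sqr_mul _ _ 2 _ m.-1) ?size_subCX2 // => j; clear -m0; lia.
- have := sqrt_div_taylor (2 * m + 1) f_gt0 (lt0r_neq0 hl).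
  rewrite /Ccoef /taylor_poly.
  congr (_ %| _); congr (_ ^+ 2 * _ - _).
  apply/polyP => i; rewrite !coef_poly; case: ifP => // _; congr (taylor_coef _ i).
  by apply/funext => x; have /(congr1 (fun h => h x)) /= -> := fE.
Qed.

(** Here S = sqrt f, deg P <= m and deg Q <= m - 2: a matrix of order m - 1 with index shift 3. *)
Lemma pell_even m : (1 < m)%N ->
  pell_solvable 1 (cubic a b l) (2 * m) <->
  \det (\matrix_(i < m.-1, j < m.-1) Bcoef a b l (i.+1 + j.+1 + 1)%N) = 0.
Proof.
move=> m1; have -> : \matrix_(i < m.-1, j < m.-1) Bcoef a b l (i.+1 + j.+1 + 1)%N =
   \matrix_(i < m.-1, j < m.-1) Bcoef a b l (i + j + 3)%N.
  by apply/matrixP => i j; rewrite !mxE; congr Bcoef; clear; lia.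
apply: (@pell_solvable_hankel _ _ _ (Bcoef a b l) _ m).
- by clear -m1; lia.
- by clear -m1; lia.
- by rewrite mul1r size_cubic.
- by rewrite hornerC oner_neq0.
- by rewrite /Bcoef taylor_coef0 !subr0.
- by move=> P; rewrite (@size_sqr_mul _ _ 0 _ m) ?size_poly1 // => j; lia.
- move=> Q; have -> : (2 * m = (2 * m).-1.+1)%N by clear -m1; lia.
  have -> : (m.-1 = m.-2.+1)%N by clear -m1; lia.
  by rewrite (@size_sqr_mul _ _ 3 _ m.-2) ?size_cubic // => j; clear -m1; lia.
- have := sqrt_taylor (2 * m) f_gt0.
  by rewrite mulr1 /Bcoef /taylor_poly fE.
Qed.

Lemma unit_pell_odd n : (0 < n)%N -> odd n -> unit_pell a b l s n <->
  pell_solvable (l%:P - 'X) ((a%:P - 'X) * (b%:P - 'X)) n.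
Proof.
move=> n0 on; split.
  have ab : a != b by rewrite gt_eqF.
  by case/(pell_of_unit_pell n0 s0 (lt0r_neq0 hl) ab) => -[]; rewrite ?on.
apply: unit_pell_of_pell => //.
- by rewrite mulrC.
- by rewrite size_subCX size_subCX2.
- by rewrite hornerD hornerN hornerC hornerX subr0 gt_eqF.
- by rewrite hornerM hornerD hornerN hornerC hornerX subrr mul0r.
- by rewrite mulrC hornerM hornerD hornerN hornerC hornerX subrr mul0r.
Qed.

Lemma unit_pell_even n : (0 < n)%N -> ~~ odd n -> unit_pell a b l s n <->
  pell_solvable 1 (cubic a b l) n.
Proof.
move=> n0 on; split.
  have ab : a != b by rewrite gt_eqF.
  case/(pell_of_unit_pell n0 s0 (lt0r_neq0 hl) ab) => -[] //.
  by rewrite (negPf on).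
apply: unit_pell_of_pell => //.
- by rewrite mul1r.
- by rewrite size_poly1 size_cubic.
- by rewrite hornerC oner_neq0.
- by rewrite horner_cubic subrr !mul0r.
- by rewrite horner_cubic subrr mulr0 mul0r.
Qed.

End Caustic.

(* The matrix indices i, j below start at 0, hence the successors. *)
Theorem theorem2p3 (R : realType) (a b lam0 : R) (n : nat)
  (hb : 0 < b) (hab : b < a)
  (hlam : (0 < lam0 < b) || (b < lam0 < a)) (hn : (3 <= n)%N) :
  (forall m : nat, n = (2 * m + 1)%N ->
    (trajectories_periodic a b lam0 n <->
     \det (\matrix_(i < m, j < m) Ccoef a b lam0 (i.+1 + j.+1)%N) = 0)) /\
  (forall m : nat, n = (2 * m)%N ->
    (trajectories_periodic a b lam0 n <->
     \det (\matrix_(i < m.-1, j < m.-1)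
             Bcoef a b lam0 (i.+1 + j.+1 + 1)%N) = 0)).
Proof.
have [l0 la lb] : [/\ 0 < lam0, lam0 < a & lam0 != b].
  case/orP: hlam => /andP[h1 h2].
    by rewrite h1 (lt_trans h2 hab) lt_eqF.
  by rewrite (lt_trans hb h1) h2 gt_eqF.
have n0 : (0 < n)%N by exact: leq_trans hn.
have per := trajectories_periodicP hb hab l0 la lb n0.
split=> m nm.
  have on : odd n by rewrite nm mul2n addn1 /= odd_double.
  apply: iff_trans per _; apply: iff_trans (unit_pell_odd hb hab l0 n0 on) _.
  rewrite nm; apply: pell_odd => //.
  by move: hn; rewrite nm; case: (m).
have on : ~~ odd n by rewrite nm mul2n odd_double.
apply: iff_trans per _; apply: iff_trans (unit_pell_even hb hab l0 n0 on) _.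
rewrite nm; apply: pell_even => //.
by move: hn; rewrite nm; case: (m) => [|[]].
Qed.
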